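(* Let $k\in\frac12\mathbb{Z}$ and let $f:\mathbb{H}\to\mathbb{C}^m$ be given by an absolutely convergent series \[f(\tau)=\sum_{j=1}^m\sum_{n\gg-\infty}c^+_{f,j}(n)e^{2\pi i(n+\kappa_j)\tau}\mathbf{e}_j+\sum_{j=1}^m\sum_{n+\kappa_j<0}c^-_{f,j}(n)\Gamma(1-k,-4\pi(n+\kappa_j)v)e^{2\pi i(n+\kappa_j)\tau}\mathbf{e}_j\] ($\tau=u+iv$). Then: \begin{enumerate} \item for every $\varphi\in\mathcal{F}_f$, $L_f(\varphi)=\int_0^\infty f(iy)\varphi(y)\,dy$; \item for every $\varphi\in\mathcal{F}_{\delta_kf}$, $L_{\delta_kf}(\varphi)=\int_0^\infty(\delta_kf)(iy)\varphi(y)\,dy$. \end{enumerate}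
   Context: $\mathbf{e}_1,\dots,\mathbf{e}_m$ is the standard basis of $\mathbb{C}^m$, $\kappa_1,\dots,\kappa_m\in[0,1)$ are fixed, and $\Gamma(a,w)$ is the (analytically continued) incomplete gamma function $\int_w^\infty e^{-t}t^{a-1}dt$. Let $n_0\in\mathbb{N}$ be such that $f_j(\tau)=O(e^{2\pi n_0v})$ as $v\to\infty$ for each $j$. $\mathcal{L}$ is the Laplace transform $(\mathcal{L}\varphi)(s)=\int_0^\infty e^{-st}\varphi(t)dt$, and for a function $\varphi$ and $s\in\mathbb{C}$, $\varphi_s(x):=\varphi(x)x^{s-1}$. All test functions are piecewise smooth complex-valued functions. $\mathcal{F}_f$ is the space of $\varphi$ such that (i) $(\mathcal{L}\varphi)(s)$ converges absolutely for $\mathrm{Re}(s)\ge-2\pi n_0$; (ii) $(\mathcal{L}\varphi_{2-k})(s)$ converges absolutely for $\mathrm{Re}(s)>0$; (iii) for each $j$, $\sum_n|c^+_{f,j}(n)|(\mathcal{L}|\varphi|)(2\pi(n+\kappa_j))+\sum_{n+\kappa_j<0}|c^-_{f,j}(n)|(4\pi|n+\kappa_j|)^{1-k}\int_0^\infty\frac{(\mathcal{L}|\varphi_{2-k}|)(-2\pi(n+\kappa_j)(2t+1))}{(1+t)^k}dt$ converges. For $\varphi\in\mathcal{F}_f$, \[L_f(\varphi):=\sum_{j}\sum_nc^+_{f,j}(n)(\mathcal{L}\varphi)(2\pi(n+\kappa_j))\mathbf{e}_j+\sum_j\sum_{n+\kappa_j<0}c^-_{f,j}(n)(-4\pi(n+\kappa_j))^{1-k}\int_0^\infty\frac{(\mathcal{L}\varphi_{2-k})(-2\pi(n+\kappa_j)(2t+1))}{(1+t)^k}dt\,\mathbf{e}_j.\]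 Define $(\delta_kf)(\tau):=\tau\frac{\partial f}{\partial u}(\tau)+\frac k2f(\tau)$. $\mathcal{F}_{\delta_kf}$ is the space of $\varphi$ such that (i) $(\mathcal{L}\varphi)(s)$ converges absolutely for $\mathrm{Re}(s)\ge-2\pi n_0$; (ii) $(\mathcal{L}\varphi_{3-k})(s)$ converges absolutely for $\mathrm{Re}(s)>0$; (iii) for each $j$, $\sum_n|c^+_{f,j}(n)(n+\kappa_j)|(\mathcal{L}|\varphi_2|)(2\pi(n+\kappa_j))+\sum_{n+\kappa_j<0}|c^-_{f,j}(n)(n+\kappa_j)|(4\pi|n+\kappa_j|)^{1-k}\int_0^\infty\frac{(\mathcal{L}|\varphi_{3-k}|)(-2\pi(n+\kappa_j)(2t+1))}{(1+t)^k}dt$ converges. For $\varphi\in\mathcal{F}_{\delta_kf}$, \[L_{\delta_kf}(\varphi):=\tfrac k2L_f(\varphi)-2\pi\sum_j\sum_nc^+_{f,j}(n)(n+\kappa_j)(\mathcal{L}\varphi_2)(2\pi(n+\kappa_j))\mathbf{e}_j-2\pi\sum_j\sum_{n+\kappa_j<0}c^-_{f,j}(n)(n+\kappa_j)(-4\pi(n+\kappa_j))^{1-k}\int_0^\infty\frac{(\mathcal{L}\varphi_{3-k})(-2\pi(n+\kappa_j)(2t+1))}{(1+t)^k}dt\,\mathbf{e}_j.\]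
   Formalization: In part 2, when k ≠ 0, φ is also assumed to lie in F_f, since L_{δ_k f}(φ) contains (k/2)L_f(φ), which is defined only for φ in F_f, and F_{δ_k f} is not contained in F_f (both sides can diverge otherwise). *)

(* Defs.v *)
From HB Require Import structures.
From mathcomp Require Import all_boot all_order all_algebra.
From mathcomp Require Import all_classical all_reals all_analysis.
From mathcomp Require Import complex.

Set Implicit Arguments.
Unset Strict Implicit.
Unset Printing Implicit Defensive.

Import Order.TTheory GRing.Theory Num.Theory.
Import numFieldNormedType.Exports.
Import Normc.

Local Open Scope classical_set_scope.
Local Open Scope ring_scope.
Local Open Scope complex_scope.

Definition cexp (R : realType) (z : R[i]) : R[i] :=
  (expR (complex.Re z) * cos (complex.Im z))
    +i* (expR (complex.Re z) * sin (complex.Im z)).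

Definition posreal (R : realType) : set R := `]0, +oo[%classic.

(* Integral of a complex-valued function, by real and imaginary parts. *)
Definition cint (R : realType) (D : set R) (g : R -> R[i]) : R[i] :=
  Rintegral lebesgue_measure D (fun x => complex.Re (g x))
    +i* Rintegral lebesgue_measure D (fun x => complex.Im (g x)).

(* Absolute convergence of the integral of g over D. *)
Definition cintegrable (R : realType) (D : set R) (g : R -> R[i]) : Prop :=
  [/\ measurable_fun D (fun x => complex.Re (g x)),
      measurable_fun D (fun x => complex.Im (g x)) &
      (\int[lebesgue_measure]_(x in D) (normc (g x))%:E < +oo)%E].

(* Unordered sums over a set of integers; the value is meaningful only for
   absolutely convergent families. *)
Definition rsum (R : realType) (D : set int) (F : int -> R) : R :=
  fine (\esum_(n in D) (Num.max (F n) 0)%:E)%E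
    - fine (\esum_(n in D) (Num.max (- F n) 0)%:E)%E.

Definition csum (R : realType) (D : set int) (F : int -> R[i]) : R[i] :=
  rsum D (fun n => complex.Re (F n)) +i* rsum D (fun n => complex.Im (F n)).

Definition csummable (R : realType) (D : set int) (F : int -> R[i]) : Prop :=
  (\esum_(n in D) (normc (F n))%:E < +oo)%E.

(* Only needed for w > 0, where the integral converges for every real a and so
   agrees with the analytic continuation. *)
Definition inc_gamma (R : realType) (a w : R) : R :=
  Rintegral lebesgue_measure `]w, +oo[%classic
    (fun t => expR (- t) * t `^ (a - 1)).

Definition laplace (R : realType) (phi : R -> R[i]) (s : R[i]) : R[i] :=
  cint (@posreal R) (fun t => cexp (- (s * t%:C)) * phi t).

Definition laplace_abscvg (R : realType) (phi : R -> R[i]) (s : R[i]) : Prop :=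
  cintegrable (@posreal R) (fun t => cexp (- (s * t%:C)) * phi t).

(* (L|phi|)(s) at a real point s, possibly +oo. *)
Definition laplace_norm (R : realType) (phi : R -> R[i]) (s : R) : \bar R :=
  (\int[lebesgue_measure]_(t in @posreal R)
     (expR (- (s * t)) * normc (phi t))%:E)%E.

(* phi_s(x) = phi(x) x^(s-1); only real s are needed. *)
Definition twist (R : realType) (phi : R -> R[i]) (s : R) : R -> R[i] :=
  fun x => phi x * (x `^ (s - 1))%:C.

(* g is smooth on (0,oo) away from a set S of breakpoints that is locally
   finite in (0,oo), and all its derivatives have finite one-sided limits at
   the breakpoints. *)
Definition piecewise_smooth_real (R : realType) (g : R -> R) : Prop :=
  exists S : set R,
    [/\ forall a b : R, 0 < a -> finite_set (S `&` `[a, b]%classic),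
        forall (x : R) (p : nat), 0 < x -> ~ S x -> derivable (derive1n p g) x 1 &
        forall (x : R) (p : nat), 0 < x -> S x ->
          cvg (derive1n p g y @[y --> x^'+]) /\ cvg (derive1n p g y @[y --> x^'-])].

Definition piecewise_smooth (R : realType) (phi : R -> R[i]) : Prop :=
  piecewise_smooth_real (fun x => complex.Re (phi x)) /\
  piecewise_smooth_real (fun x => complex.Im (phi x)).

Definition freq (R : realType) (kap : R) (n : int) : R := n%:~R + kap.

Definition negfreq (R : realType) (kap : R) : set int :=
  [set n | freq kap n < 0].

Section Series.
Context (R : realType) (m : nat) (k : R) (kap : 'I_m -> R) (n0 : nat).
Context (cp cm : 'I_m -> int -> R[i]).

Definition plus_term (j : 'I_m) (tau : R[i]) (n : int) : R[i] :=
  cp j n * cexp ((0 +i* 1) * (2 * pi * freq (kap j) n)%:C * tau).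

Definition minus_term (j : 'I_m) (tau : R[i]) (n : int) : R[i] :=
  cm j n * (inc_gamma (1 - k) (- (4 * pi * freq (kap j) n * complex.Im tau)))%:C
    * cexp ((0 +i* 1) * (2 * pi * freq (kap j) n)%:C * tau).

Definition has_expansion (f : R[i] -> 'rV[R[i]]_m) : Prop :=
  (exists N : int, forall (j : 'I_m) (n : int), n < N -> cp j n = 0) /\
  forall tau : R[i], 0 < complex.Im tau ->
    (forall j : 'I_m, csummable setT (plus_term j tau) /\
                      csummable (negfreq (kap j)) (minus_term j tau)) /\
    f tau = \row_j (csum setT (plus_term j tau)
                    + csum (negfreq (kap j)) (minus_term j tau)).

(* f_j(tau) = O(e^(2 pi n0 v)) as v -> oo, uniformly in u. *)
Definition growth_bound (f : R[i] -> 'rV[R[i]]_m) : Prop :=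
  forall j : 'I_m, exists A V : R, forall u v : R, 0 < v -> V <= v ->
    normc (f (u +i* v) ord0 j) <= A * expR (2 * pi * n0%:R * v).

Definition F_f (phi : R -> R[i]) : Prop :=
  [/\ piecewise_smooth phi,
      forall s : R[i], - (2 * pi * n0%:R) <= complex.Re s -> laplace_abscvg phi s,
      forall s : R[i], 0 < complex.Re s -> laplace_abscvg (twist phi (2 - k)) s &
      forall j : 'I_m,
        (\esum_(n in [set: int])
            ((normc (cp j n))%:E * laplace_norm phi (2 * pi * freq (kap j) n))
         + \esum_(n in negfreq (kap j))
            ((normc (cm j n) * (4 * pi * `|freq (kap j) n|) `^ (1 - k))%R%:E *
             \int[lebesgue_measure]_(t in @posreal R)
               (laplace_norm (twist phi (2 - k))
                  (- (2 * pi * freq (kap j) n * (2 * t + 1)))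
                * (((1 + t) `^ k)^-1)%R%:E))
         < +oo)%E].

Definition L_f (phi : R -> R[i]) : 'rV[R[i]]_m :=
  \row_j
    (csum setT (fun n => cp j n * laplace phi (2 * pi * freq (kap j) n)%:C)
     + csum (negfreq (kap j)) (fun n =>
         cm j n * ((- (4 * pi * freq (kap j) n)) `^ (1 - k))%:C *
         cint (@posreal R) (fun t =>
           laplace (twist phi (2 - k))
             (- (2 * pi * freq (kap j) n * (2 * t + 1)))%:C
           / ((1 + t) `^ k)%:C))).

Definition F_delta (phi : R -> R[i]) : Prop :=
  [/\ piecewise_smooth phi,
      forall s : R[i], - (2 * pi * n0%:R) <= complex.Re s -> laplace_abscvg phi s,
      forall s : R[i], 0 < complex.Re s -> laplace_abscvg (twist phi (3 - k)) s &
      forall j : 'I_m,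
        (\esum_(n in [set: int])
            ((normc (cp j n * (freq (kap j) n)%:C))%:E *
             laplace_norm (twist phi 2) (2 * pi * freq (kap j) n))
         + \esum_(n in negfreq (kap j))
            ((normc (cm j n * (freq (kap j) n)%:C)
              * (4 * pi * `|freq (kap j) n|) `^ (1 - k))%R%:E *
             \int[lebesgue_measure]_(t in @posreal R)
               (laplace_norm (twist phi (3 - k))
                  (- (2 * pi * freq (kap j) n * (2 * t + 1)))
                * (((1 + t) `^ k)^-1)%R%:E))
         < +oo)%E].

Definition L_delta (phi : R -> R[i]) : 'rV[R[i]]_m :=
  (k / 2)%:C *: L_f phi
  - (2 * pi)%:C *: (\row_j
      csum setT (fun n => cp j n * (freq (kap j) n)%:C *
        laplace (twist phi 2) (2 * pi * freq (kap j) n)%:C))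
  - (2 * pi)%:C *: (\row_j
      csum (negfreq (kap j)) (fun n =>
         cm j n * (freq (kap j) n)%:C
         * ((- (4 * pi * freq (kap j) n)) `^ (1 - k))%:C *
         cint (@posreal R) (fun t =>
           laplace (twist phi (3 - k))
             (- (2 * pi * freq (kap j) n * (2 * t + 1)))%:C
           / ((1 + t) `^ k)%:C))).

Definition partial_u (f : R[i] -> 'rV[R[i]]_m) (tau : R[i]) : 'rV[R[i]]_m :=
  \row_j
    (derive1 (fun u : R => complex.Re (f (u +i* complex.Im tau) ord0 j))
       (complex.Re tau)
     +i* derive1 (fun u : R => complex.Im (f (u +i* complex.Im tau) ord0 j))
       (complex.Re tau)).

Definition delta (f : R[i] -> 'rV[R[i]]_m) (tau : R[i]) : 'rV[R[i]]_m :=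
  tau *: partial_u f tau + (k / 2)%:C *: f tau.

(* Integral over (0,oo) of y |-> g(iy) phi(y), componentwise. *)
Definition axis_integrable (g : R[i] -> 'rV[R[i]]_m) (phi : R -> R[i]) : Prop :=
  forall j : 'I_m,
    cintegrable (@posreal R) (fun y => g (0 +i* y) ord0 j * phi y).

Definition axis_integral (g : R[i] -> 'rV[R[i]]_m) (phi : R -> R[i]) :
  'rV[R[i]]_m :=
  \row_j cint (@posreal R) (fun y => g (0 +i* y) ord0 j * phi y).

End Series.

(* Main.v *)
(** On the imaginary axis every term of the expansion of [f] is a coefficient
    times a nonnegative weight.  For the holomorphic part the weight is
    [exp (- 2 pi (n + kappa) y)], whose integral against [phi] is a Laplace
    transform.  For the nonholomorphic part, with [b = - 2 pi (n + kappa) > 0],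
    substituting [w (1 + t)] for [t] in the integral of [Gamma (1 - k, w)] gives
    [Gamma (1 - k, 2 b y) e^(b y)
       = (2 b)^(1 - k) int_0^oo y^(1 - k) e^(- b (2 t + 1) y) (1 + t)^(- k) dt],
    and Fubini in [(y, t)] turns its integral against [phi] into the double
    integral of [L_f].  The summability conditions in [F_f] and [F_delta] are
    exactly what Tonelli needs to exchange sum and integral.

    For [delta_k f] the series is differentiated termwise in [u] at [u = 0].
    The remainder [e^(i th u) - 1 - i th u] is [O(th^2 u^2)], so it suffices that
    the terms times [(n + kappa)^2] are summable at height [y]; they are dominated
    by the terms of the expansion at height [y / 2]. *)

Require Import Defs.
From HB Require Import structures.
From mathcomp Require Import all_boot all_order all_algebra.
From mathcomp Require Import all_classical all_reals all_analysis.
From mathcomp Require Import complex measurable_realfun ring lra.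

Set Implicit Arguments.
Unset Strict Implicit.
Unset Printing Implicit Defensive.

Import Order.TTheory GRing.Theory Num.Theory.
Import numFieldNormedType.Exports.
Import Normc.

Local Open Scope classical_set_scope.
Local Open Scope ring_scope.
Local Open Scope complex_scope.

(** * Sums over countable sets and their integrals *)

(** Part (2) is the computation of part (1) for other data. On the axis the operator tau d/du
    multiplies a term of frequency n + kappa by (iy)(2 pi i (n + kappa)) = - 2 pi (n + kappa) y. The
    factor n + kappa goes into the coefficient and y into the test function, which becomes phi_2,
    and (phi_2)_(2-k) = phi_(3-k). Termwise integration is therefore proved for arbitrary
    coefficients.

    Sums and integrals are total functions here: they take [fine] of extended reals, which sends an
    infinite value to 0. Every identity thus travels with the finiteness that gives it meaning, and
    a term with zero coefficient, whose Laplace transform may diverge, is treated apart.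

    Halving the height pays for (n + kappa)^2 because a weight at height y is bounded by the weight
    at y / 2 times an exponential that decays in |n + kappa| y. The exception is the negative
    frequencies of the holomorphic part, and these are bounded. *)

Lemma esum_countType {R : realType} {T : countType} (D : set T) (a : T -> \bar R) :
  (forall i, D i -> (0 <= a i)%E) ->
  (\esum_(i in D) a i =
   \sum_(j <oo) oapp (fun i => if i \in D then a i else 0) 0 (@pickle_inv T j))%E.
Proof.
move=> a0; rewrite esum_mkcond.
pose b i := (if i \in D then a i else 0)%E.
(* Natural numbers that code no element of [T] contribute 0, so the series over all of [nat] equals
   the sum over the image of [pickle]. *)
pose c (j : nat) := oapp b 0%E (@pickle_inv T j).
rewrite -[LHS]/(\esum_(i in setT) b i)%E -[RHS]/(\sum_(j <oo) c j)%E.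
have cb (i : T) : c (pickle i) = b i by rewrite /c pickleK_inv.
have b0 i : (0 <= b i)%E by rewrite /b; case: ifPn => // /set_mem; exact: a0.
have c0 j : (0 <= c j)%E by rewrite /c; case: pickle_inv => //= i; exact: b0.
rewrite nneseries_esumT//.
rewrite (eq_esum (b := c \o pickle)); last by move=> i _ /=; rewrite cb.
rewrite -(@esum_image _ _ _ setT (@pickle T) c); last first.
  by move=> i j _ _; exact: (pcan_inj pickleK).
rewrite esum_mkcond; apply: eq_esum => j _.
case: ifPn => // /negP nj; rewrite /c.
case E : (@pickle_inv T j) => [i|]//=; exfalso; apply: nj.
by rewrite inE; exists i => //; have := @pickle_invK T j; rewrite E.
Qed.

Lemma esumZl {R : realType} {T : countType} (D : set T) (r : R) (a : T -> \bar R) :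
  0 <= r -> (forall i, D i -> (0 <= a i)%E) ->
  (\esum_(i in D) (r%:E * a i) = r%:E * \esum_(i in D) a i)%E.
Proof.
move=> r0 a0; rewrite !esum_countType//; last first.
  by move=> i Di; rewrite mule_ge0// ?lee_fin// a0.
rewrite -nneseriesZl//; last first.
  by move=> j _; case: pickle_inv => //= i; case: ifPn => // /set_mem; exact: a0.
apply: eq_eseriesr => j _; case: pickle_inv => [i|]/=; last by rewrite mule0.
by case: ifPn => // _; rewrite mule0.
Qed.

Lemma esum_lty_term {R : realType} {T : choiceType} (D : set T) (a : T -> \bar R) n :
  (forall i, D i -> (0 <= a i)%E) -> (\esum_(i in D) a i < +oo)%E -> D n ->
  (a n < +oo)%E.
Proof.
move=> a0 aoo Dn; apply: le_lt_trans aoo.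
by apply: esum_ge; exists [set n]; [split => // i ->|rewrite fsbig_set1].
Qed.

Section integral_esum.
Context {d : measure_display} {X : measurableType d} {R : realType}.
Variables (mu : {measure set X -> \bar R}) (T : countType).
Variables (E : set X) (mE : measurable E) (D : set T) (a : T -> X -> \bar R).
Hypothesis ma : forall n, D n -> measurable_fun E (a n).
Hypothesis a0 : forall n x, D n -> E x -> (0 <= a n x)%E.

Let b (j : nat) (x : X) : \bar R :=
  (oapp (fun i => if i \in D then a i x else 0) 0 (@pickle_inv T j))%E.

Let mb j : measurable_fun E (b j).
Proof.
rewrite /b; case: (@pickle_inv T j) => [i|]/=; last exact: measurable_cst.
by case: (boolP (i \in D)) => [/set_mem|_]; [exact: ma|exact: measurable_cst].
Qed.

Let b0 j x : E x -> (0 <= b j x)%E.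
Proof.
by move=> Ex; rewrite /b; case: (@pickle_inv T j) => [i|]//=;
  case: ifPn => // /set_mem Di; exact: a0.
Qed.

Let esumE x : E x -> (\esum_(n in D) a n x = \sum_(j <oo) b j x)%E.
Proof. by move=> Ex; rewrite esum_countType// => i Di; exact: a0. Qed.

Lemma measurable_esum : measurable_fun E (fun x => \esum_(n in D) a n x)%E.
Proof.
apply: (eq_measurable_fun (fun x => \sum_(j <oo) b j x)%E).
  by move=> x /set_mem Ex; rewrite esumE.
by apply: ge0_emeasurable_sum => // j x Ex _; exact: b0.
Qed.

Lemma integral_esum :
  (\int[mu]_(x in E) (\esum_(n in D) a n x) =
   \esum_(n in D) \int[mu]_(x in E) a n x)%E.
Proof.
transitivity (\int[mu]_(x in E) (\sum_(j <oo) b j x))%E.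
  by apply: eq_integral => x /set_mem Ex; rewrite esumE.
rewrite integral_nneseries// esum_countType; last first.
  by move=> i Di; apply: integral_ge0 => x Ex; exact: a0.
apply: eq_eseriesr => j _; rewrite /b; case: (@pickle_inv T j) => [i|]/=.
  by case: (boolP (i \in D)) => // _; rewrite integral0.
by rewrite integral0.
Qed.

End integral_esum.

(** * Linearity and bounds for signed sums over sets of integers *)

Section rsum.
Context {R : realType}.
Implicit Types (D : set int) (A B F G : int -> R).

Local Notation summableR D F := (\esum_(n in D) (`|F n|)%:E < +oo)%E.

Lemma ge0_fine_esum D A : (forall n, D n -> 0 <= A n) -> summableR D A ->
  (\esum_(n in D) (A n)%:E)%E \is a fin_num.
Proof.
move=> A0 sA; rewrite ge0_fin_numE; last first.
  by apply: esum_ge0 => n Dn; rewrite lee_fin A0.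
by apply: le_lt_trans sA; apply: le_esum => n Dn; rewrite lee_fin ler_norm.
Qed.

Lemma le_summableR D F G : (forall n, D n -> `|F n| <= `|G n|) ->
  summableR D G -> summableR D F.
Proof.
by move=> FG; apply: le_lt_trans; apply: le_esum => n Dn; rewrite lee_fin FG.
Qed.

Lemma summableRD D F G : summableR D F -> summableR D G ->
  summableR D (fun n => F n + G n).
Proof.
move=> sF sG; apply: le_lt_trans (lte_add_pinfty sF sG).
rewrite -esumD//; apply: le_esum => n Dn.
by rewrite -EFinD lee_fin ler_normD.
Qed.

Lemma summableRZ D r F : summableR D F -> summableR D (fun n => r * F n).
Proof.
move=> sF; under eq_esum do rewrite normrM EFinM.
by rewrite esumZl//; apply: lte_mul_pinfty; rewrite ?lee_fin.
Qed.

(** Positive and negative parts are not additive, so linearity cannot be read off the definition of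
    [rsum]. Here any splitting into nonnegative summable families is allowed, which is what sums and
    integrals of [F] naturally produce. *)
Lemma rsum_sub D A B F : (forall n, D n -> 0 <= A n) -> (forall n, D n -> 0 <= B n) ->
  summableR D A -> summableR D B -> (forall n, D n -> F n = A n - B n) ->
  rsum D F = fine (\esum_(n in D) (A n)%:E)%E - fine (\esum_(n in D) (B n)%:E)%E.
Proof.
move=> A0 B0 sA sB FE.
have mx n : D n -> ((Num.max (F n) 0)%:E = ((EFin \o A) \- (EFin \o B))^\+ n)%E.
  by move=> Dn; rewrite FE// funeposE EFin_max.
have mn n : D n -> ((Num.max (- F n) 0)%:E = ((EFin \o A) \- (EFin \o B))^\- n)%E.
  by move=> Dn; rewrite FE// funenegE EFin_max.
have sF : summableR D F.
  apply: (@le_summableR _ _ (fun n => A n + B n)) => [n Dn|].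
    rewrite FE// (le_trans (ler_normB _ _))// !ger0_norm ?addr_ge0 ?A0 ?B0//.
  exact: summableRD.
rewrite /rsum -!fineB.
- congr fine; rewrite (eq_esum mx) (eq_esum mn) esumB//.
- by apply: ge0_fine_esum.
- by apply: ge0_fine_esum.
- apply: ge0_fine_esum => [n _|]; first by rewrite le_max lexx orbT.
  apply: le_summableR sF => n Dn; rewrite ger0_norm ?le_max ?lexx ?orbT//.
  by rewrite ge_max ler_norm normr_ge0.
- apply: ge0_fine_esum => [n _|]; first by rewrite le_max lexx orbT.
  apply: le_summableR sF => n Dn; rewrite ger0_norm ?le_max ?lexx ?orbT//.
  by rewrite ge_max -normrN ler_norm normr_ge0.
Qed.

Let pos F n := Num.max (F n) 0.
Let neg F n := Num.max (- F n) 0.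

Let pos_ge0 F n : 0 <= pos F n. Proof. by rewrite le_max lexx orbT. Qed.
Let neg_ge0 F n : 0 <= neg F n. Proof. by rewrite le_max lexx orbT. Qed.
Let pos_le F n : `|pos F n| <= `|F n|.
Proof. by rewrite ger0_norm// ge_max ler_norm normr_ge0. Qed.
Let neg_le F n : `|neg F n| <= `|F n|.
Proof. by rewrite ger0_norm// ge_max -normrN ler_norm normr_ge0. Qed.
Let posneg F n : F n = pos F n - neg F n.
Proof.
rewrite /pos /neg; case: (leP 0 (F n)) => h.
  by rewrite max_r ?subr0// oppr_le0.
by rewrite max_l ?opprK ?add0r// oppr_ge0 ltW.
Qed.

Let spos {D F} : summableR D F -> summableR D (pos F).
Proof. by apply: le_summableR => n _. Qed.
Let sneg {D F} : summableR D F -> summableR D (neg F).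
Proof. by apply: le_summableR => n _. Qed.

Lemma eq_rsum D F G : (forall n, D n -> F n = G n) -> rsum D F = rsum D G.
Proof.
by move=> FG; rewrite /rsum; congr (fine _ - fine _); apply: eq_esum => n Dn;
  rewrite FG.
Qed.

Lemma rsumD D F G : summableR D F -> summableR D G ->
  rsum D (fun n => F n + G n) = rsum D F + rsum D G.
Proof.
move=> sF sG.
rewrite (@rsum_sub D (fun n => pos F n + pos G n) (fun n => neg F n + neg G n)).
- under eq_esum do rewrite EFinD.
  under [in X in _ - X]eq_esum do rewrite EFinD.
  rewrite !esumD ?fineD; try by [apply: ge0_fine_esum => //; [exact: spos|exact: sneg]|
    move=> *; rewrite lee_fin].
  + by rewrite /rsum opprD addrACA.
  + by apply: ge0_fine_esum => //; exact: sneg.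
  + by apply: ge0_fine_esum => //; exact: sneg.
  + by apply: ge0_fine_esum => //; exact: spos.
  + by apply: ge0_fine_esum => //; exact: spos.
- by move=> n _; rewrite addr_ge0.
- by move=> n _; rewrite addr_ge0.
- by apply: summableRD; exact: spos.
- by apply: summableRD; exact: sneg.
- by move=> n _; rewrite {1}(posneg F) {1}(posneg G) opprD addrACA.
Qed.

Lemma rsumN D F : rsum D (fun n => - F n) = - rsum D F.
Proof.
rewrite /rsum opprB; congr (_ - fine _).
by apply: eq_esum => n _; rewrite opprK.
Qed.

Lemma rsumZ D r F : summableR D F -> rsum D (fun n => r * F n) = r * rsum D F.
Proof.
(* A negative factor swaps the two parts of [G]; that case is reduced to this one through
   [rsumN]. *)
have ge0Z s G : 0 <= s -> summableR D G ->
    rsum D (fun n => s * G n) = s * rsum D G.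
  move=> s0 sG.
  rewrite (@rsum_sub D (fun n => s * pos G n) (fun n => s * neg G n)).
  - under eq_esum do rewrite EFinM.
    under [in X in _ - X]eq_esum do rewrite EFinM.
    rewrite !esumZl// ?fineM//; try (by move=> *; rewrite lee_fin).
    + by rewrite /= -mulrBr.
    + by apply: ge0_fine_esum => //; exact: sneg.
    + by apply: ge0_fine_esum => //; exact: spos.
  - by move=> n _; rewrite mulr_ge0.
  - by move=> n _; rewrite mulr_ge0.
  - by apply: summableRZ; exact: spos.
  - by apply: summableRZ; exact: sneg.
  - by move=> n _; rewrite {1}(posneg G) mulrBr.
move=> sF; have [r0|r0] := leP 0 r; first exact: ge0Z.
have -> : rsum D (fun n => r * F n) = rsum D (fun n => - (- r * F n)).
  by apply: eq_rsum => n _; rewrite mulNr opprK.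
by rewrite rsumN ge0Z ?oppr_ge0 ?ltW// mulNr opprK.
Qed.

Lemma ler_norm_rsum D F : summableR D F ->
  `|rsum D F| <= fine (\esum_(n in D) (`|F n|)%:E)%E.
Proof.
move=> sF; rewrite (le_trans (ler_normB _ _))//.
have fp : (\esum_(n in D) (pos F n)%:E)%E \is a fin_num.
  by apply: ge0_fine_esum => //; exact: spos.
have fn : (\esum_(n in D) (neg F n)%:E)%E \is a fin_num.
  by apply: ge0_fine_esum => //; exact: sneg.
have p0 n : D n -> (0 <= (pos F n)%:E)%E by rewrite lee_fin.
have q0 n : D n -> (0 <= (neg F n)%:E)%E by rewrite lee_fin.
rewrite !ger0_norm; [|by apply: fine_ge0; exact: esum_ge0..].
rewrite -fineD// -esumD//.
rewrite fine_le//.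
- by rewrite esumD// fin_numD fp fn.
- by apply: ge0_fine_esum => //; apply: le_summableR sF => n _; rewrite normr_id.
apply: le_esum => n _; rewrite -EFinD lee_fin.
case/orP: (le_total 0 (F n)) => h.
  by rewrite (max_l h) max_r ?oppr_le0// addr0 ger0_norm.
by rewrite (max_r h) max_l ?oppr_ge0// add0r ler0_norm.
Qed.

End rsum.

(** * Exchange of a signed sum with an integral *)

Section rsum_integral.
Context {d : measure_display} {X : measurableType d} {R : realType}.
Variables (mu : {measure set X -> \bar R}).
Variables (E : set X) (mE : measurable E) (D : set int) (F : int -> X -> R).
Hypothesis mF : forall n, D n -> measurable_fun E (F n).
Hypothesis iF :
  (\esum_(n in D) \int[mu]_(x in E) (`|F n x|)%:E < +oo)%E.
Hypothesis sF : forall x, E x -> (\esum_(n in D) (`|F n x|)%:E < +oo)%E.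

(** Here [s] stands for either the positive-part or the negative-part map, so both halves of [rsum]
    are integrated by one argument. The bound by the absolute value transfers all finiteness from
    [iF] and [sF]. *)
Let part (s : R -> R) : (forall r, 0 <= s r <= `|r|) -> measurable_fun setT s ->
  let P x := (\esum_(n in D) (s (F n x))%:E)%E in
  [/\ mu.-integrable E (EFin \o (fine \o P)),
      (forall n, D n -> mu.-integrable E (EFin \o (s \o F n))),
      \int[mu]_(x in E) (fine (P x)) =
        fine (\esum_(n in D) (\int[mu]_(x in E) (s (F n x)))%:E)%E &
      (\esum_(n in D) (`|\int[mu]_(x in E) s (F n x)|)%:E < +oo)%E].
Proof.
move=> s0 ms P.
have msF n : D n -> measurable_fun E (s \o F n).
  by move=> Dn; apply: measurableT_comp => //; exact: mF.
have Pfin x : E x -> (fine (P x))%:E = P x.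
  move=> Ex; rewrite fineK//; apply: ge0_fine_esum => [n _|].
    by case/andP: (s0 (F n x)).
  apply: (@le_summableR _ _ _ (fun n => F n x)) (sF Ex) => n _.
  by case/andP: (s0 (F n x)) => h1 h2; rewrite ger0_norm.
have intP : (\int[mu]_(x in E) P x =
    \esum_(n in D) \int[mu]_(x in E) (s (F n x))%:E)%E.
  apply: integral_esum => //.
    by move=> n Dn; apply/measurable_EFinP; exact: msF.
  by move=> n x _ _; rewrite lee_fin; case/andP: (s0 (F n x)).
have le1 : (\esum_(n in D) \int[mu]_(x in E) (s (F n x))%:E < +oo)%E.
  apply: le_lt_trans iF; apply: le_esum => n Dn.
  apply: ge0_le_integral => //.
  - by move=> x Ex; rewrite lee_fin; case/andP: (s0 (F n x)).
  - by apply/measurable_EFinP; exact: msF.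
  - by apply/measurable_EFinP; apply: measurableT_comp => //; exact: mF.
  - by move=> x Ex; rewrite lee_fin; case/andP: (s0 (F n x)).
have isF n : D n -> mu.-integrable E (EFin \o (s \o F n)).
  move=> Dn; apply/integrableP; split.
    by apply/measurable_EFinP; exact: msF.
  under eq_integral => x _.
    rewrite /= ger0_norm; last by case/andP: (s0 (F n x)).
    over.
  have sn0 i : D i -> (0 <= \int[mu]_(x in E) (s (F i x))%:E)%E.
    by move=> _; apply: integral_ge0 => x _; rewrite lee_fin; case/andP: (s0 (F i x)).
  exact: (esum_lty_term sn0 le1).
have intfin n : D n -> (\int[mu]_(x in E) s (F n x))%:E =
    (\int[mu]_(x in E) (s (F n x))%:E)%E.
  by move=> Dn; rewrite /Rintegral fineK//; exact: integrable_fin_num (isF _ Dn).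
split=> //.
- apply/integrableP; split.
    apply/measurable_EFinP; apply: measurableT_comp => //.
    apply: measurable_esum => //.
      by move=> n Dn; apply/measurable_EFinP; exact: msF.
    by move=> n x _ _; rewrite lee_fin; case/andP: (s0 (F n x)).
  suff -> : (\int[mu]_(x in E) `|(EFin \o (fine \o P)) x| = \int[mu]_(x in E) P x)%E.
    by rewrite intP.
  apply: eq_integral => x /set_mem Ex; rewrite /comp Pfin// gee0_abs//.
  by apply: esum_ge0 => n _; rewrite lee_fin; case/andP: (s0 (F n x)).
- rewrite /Rintegral; congr fine.
  rewrite (eq_esum intfin) -intP.
  by apply: eq_integral => x /set_mem Ex; rewrite Pfin.
- apply: le_lt_trans le1; apply: le_esum => n Dn.
  rewrite ger0_norm ?intfin//.
  by apply: Rintegral_ge0 => x _; case/andP: (s0 (F n x)).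
Qed.

Let maxl0 (r : R) : 0 <= Num.max r 0 <= `|r|.
Proof. by rewrite le_max lexx orbT ge_max ler_norm normr_ge0. Qed.
Let maxr0 (r : R) : 0 <= Num.max (- r) 0 <= `|r|.
Proof. by rewrite le_max lexx orbT ge_max -normrN ler_norm normr_ge0. Qed.
Let mmaxl : measurable_fun setT (fun r : R => Num.max r 0).
Proof. exact: measurable_maxr. Qed.
Let mmaxr : measurable_fun setT (fun r : R => Num.max (- r) 0).
Proof. by apply: measurable_maxr => //; exact: measurableT_comp. Qed.

Lemma integrable_rsum : mu.-integrable E (EFin \o (fun x => rsum D (F ^~ x))).
Proof.
have [i1 _ _ _] := part maxl0 mmaxl.
have [i2 _ _ _] := part maxr0 mmaxr.
exact: integrableB i1 i2.
Qed.

Lemma Rintegral_rsum : \int[mu]_(x in E) rsum D (F ^~ x) =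
  rsum D (fun n => \int[mu]_(x in E) F n x).
Proof.
have [i1 j1 e1 s1] := part maxl0 mmaxl.
have [i2 j2 e2 s2] := part maxr0 mmaxr.
(* The integrals of the two parts of [F n] are in general not the two parts of its integral, hence
   the recourse to an arbitrary splitting. *)
rewrite RintegralB// e1 e2; symmetry; apply: rsum_sub => //.
- by move=> n _; apply: Rintegral_ge0 => x _; case/andP: (maxl0 (F n x)).
- by move=> n _; apply: Rintegral_ge0 => x _; case/andP: (maxr0 (F n x)).
- move=> n Dn; rewrite -RintegralB//; [|exact: j1|exact: j2].
  apply: eq_Rintegral => x _; case/orP: (le_total 0 (F n x)) => h.
    by rewrite (max_l h) max_r ?oppr_le0// subr0.
  by rewrite (max_r h) max_l ?oppr_ge0// sub0r opprK.
Qed.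

End rsum_integral.

(** * Complex-valued integrals and sums *)

Section complex_parts.
Context {R : realType}.
Implicit Types (z w : R[i]) (r : R).

Lemma ReMc z w : complex.Re (z * w) =
  complex.Re z * complex.Re w - complex.Im z * complex.Im w.
Proof. by case: z => a b; case: w. Qed.

Lemma ImMc z w : complex.Im (z * w) =
  complex.Re z * complex.Im w + complex.Im z * complex.Re w.
Proof. by case: z => a b; case: w. Qed.

Lemma ReDc z w : complex.Re (z + w) = complex.Re z + complex.Re w.
Proof. by case: z => a b; case: w. Qed.

Lemma ImDc z w : complex.Im (z + w) = complex.Im z + complex.Im w.
Proof. by case: z => a b; case: w. Qed.

Lemma ReZc r z : complex.Re (r%:C * z) = r * complex.Re z.
Proof. by rewrite ReMc /= mul0r subr0. Qed.

Lemma ImZc r z : complex.Im (r%:C * z) = r * complex.Im z.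
Proof. by rewrite ImMc /= mul0r addr0. Qed.

Lemma eq_complexP z w : complex.Re z = complex.Re w ->
  complex.Im z = complex.Im w -> z = w.
Proof. by case: z => a b; case: w => c d /= -> ->. Qed.

Lemma normcE_sqrt z :
  normc z = Num.sqrt (complex.Re z ^+ 2 + complex.Im z ^+ 2).
Proof. by case: z. Qed.

Lemma normc_ge0 z : 0 <= normc z.
Proof. by rewrite normcE_sqrt sqrtr_ge0. Qed.

Lemma normcR r : normc r%:C = `|r|.
Proof. by rewrite normcE_sqrt /= expr0n addr0 sqrtr_sqr. Qed.

Lemma normc_geRe z : `|complex.Re z| <= normc z.
Proof. by rewrite normcE_sqrt -sqrtr_sqr ler_wsqrtr// lerDl sqr_ge0. Qed.

Lemma normc_geIm z : `|complex.Im z| <= normc z.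
Proof. by rewrite normcE_sqrt -sqrtr_sqr ler_wsqrtr// lerDr sqr_ge0. Qed.

Lemma normc_leD z : normc z <= `|complex.Re z| + `|complex.Im z|.
Proof.
rewrite normcE_sqrt -[leRHS]ger0_norm ?addr_ge0// -sqrtr_sqr ler_wsqrtr//.
rewrite sqrrD !real_normK ?num_real// addrAC lerDl.
by rewrite mulrn_wge0// mulr_ge0.
Qed.

End complex_parts.

Section cint.
Context {R : realType}.
Notation mu := (@lebesgue_measure R).
Implicit Types (D : set R) (g h : R -> R[i]) (c : R[i]).

Lemma measurable_normc D g :
  measurable_fun D (fun x => complex.Re (g x)) ->
  measurable_fun D (fun x => complex.Im (g x)) ->
  measurable_fun D (fun x => normc (g x)).
Proof.
move=> mr mi.
have -> : (fun x => normc (g x)) =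
    Num.sqrt \o (fun x => complex.Re (g x) ^+ 2 + complex.Im (g x) ^+ 2).
  by apply/funext => x; rewrite normcE_sqrt.
apply: measurableT_comp.
  by apply: continuous_measurable_fun; exact: sqrt_continuous.
by apply: measurable_funD; exact: measurable_funX.
Qed.

Lemma cintegrableP D g : measurable D ->
  cintegrable D g <->
  mu.-integrable D (EFin \o (fun x => complex.Re (g x))) /\
  mu.-integrable D (EFin \o (fun x => complex.Im (g x))).
Proof.
move=> mD; split.
  move=> [mr mi goo].
  have ig : mu.-integrable D (EFin \o (fun x => normc (g x))).
    apply/integrableP; split; first by apply/measurable_EFinP; exact: measurable_normc.
    suff -> : (\int[mu]_(x in D) `|(EFin \o (fun x => normc (g x))) x| =
      \int[mu]_(x in D) (normc (g x))%:E)%E by [].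
    apply: eq_integral => x _.
    by rewrite gee0_abs// lee_fin normc_ge0.
  split; apply: le_integrable ig => //; try exact/measurable_EFinP.
  - by move=> x _; rewrite /= lee_fin [leRHS]ger0_norm ?normc_ge0// normc_geRe.
  - by move=> x _; rewrite /= lee_fin [leRHS]ger0_norm ?normc_ge0// normc_geIm.
move=> [ir ii].
have mr : measurable_fun D (fun x => complex.Re (g x)).
  by apply/measurable_EFinP; exact: (measurable_int _ ir).
have mi : measurable_fun D (fun x => complex.Im (g x)).
  by apply/measurable_EFinP; exact: (measurable_int _ ii).
split => //.
have ri : mu.-integrable D (fun x => `|(complex.Re (g x))%:E| + `|(complex.Im (g x))%:E|)%E.
  by apply: integrableD => //; [exact: integrable_abse ir|exact: integrable_abse ii].
have /integrableP[_] := ri.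
apply: le_lt_trans; apply: ge0_le_integral => //.
- by move=> x _; rewrite lee_fin normc_ge0.
- by apply/measurable_EFinP; exact: measurable_normc.
- apply: measurableT_comp => //; apply: emeasurable_funD;
    by apply: measurableT_comp => //; exact/measurable_EFinP.
- move=> x _; rewrite /= lee_fin (le_trans (normc_leD _))//.
  by rewrite [leRHS]ger0_norm ?addr_ge0.
Qed.

Lemma eq_cint D g h : (forall x, D x -> g x = h x) -> cint D g = cint D h.
Proof.
by move=> gh; rewrite /cint; congr (_ +i* _);
  apply: eq_Rintegral => x /set_mem Dx; rewrite gh.
Qed.

Lemma eq_cintegrable D g h : (forall x, D x -> g x = h x) ->
  cintegrable D g -> cintegrable D h.
Proof.
move=> gh [mr mi goo]; split.
- apply: eq_measurable_fun mr => x /set_mem Dx; by rewrite gh.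
- apply: eq_measurable_fun mi => x /set_mem Dx; by rewrite gh.
- by under eq_integral => x /set_mem Dx do rewrite -gh//.
Qed.

Lemma cintegrableD D g h : measurable D -> cintegrable D g -> cintegrable D h ->
  cintegrable D (fun x => g x + h x).
Proof.
move=> mD /(cintegrableP _ mD)[gr gi] /(cintegrableP _ mD)[hr hi].
apply/cintegrableP => //; split.
  by under eq_fun do rewrite /= ReDc; exact: integrableD gr hr.
by under eq_fun do rewrite /= ImDc; exact: integrableD gi hi.
Qed.

Lemma cintD D g h : measurable D -> cintegrable D g -> cintegrable D h ->
  cint D (fun x => g x + h x) = cint D g + cint D h.
Proof.
move=> mD /(cintegrableP _ mD)[gr gi] /(cintegrableP _ mD)[hr hi].
apply: eq_complexP; rewrite ?ReDc ?ImDc /=; rewrite -RintegralD//;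
  by apply: eq_Rintegral => x _; rewrite ?ReDc ?ImDc.
Qed.

Let integrableZR D (r : R) (f : R -> R) : measurable D ->
  mu.-integrable D (EFin \o f) -> mu.-integrable D (EFin \o (fun x => r * f x)).
Proof.
move=> mD fi.
suff : mu.-integrable D (fun x => r%:E * (f x)%:E)%E by [].
exact: integrableZl.
Qed.

Lemma cintegrableZ D c g : measurable D -> cintegrable D g ->
  cintegrable D (fun x => c * g x).
Proof.
move=> mD /(cintegrableP _ mD)[gr gi].
apply/cintegrableP => //; split.
  under eq_fun do rewrite /= ReMc.
  exact: integrableB (integrableZR _ mD gr) (integrableZR _ mD gi).
under eq_fun do rewrite /= ImMc.
exact: integrableD (integrableZR _ mD gi) (integrableZR _ mD gr).
Qed.

Lemma cintZ D c g : measurable D -> cintegrable D g ->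
  cint D (fun x => c * g x) = c * cint D g.
Proof.
move=> mD /(cintegrableP _ mD)[gr gi].
apply: eq_complexP; rewrite ?ReMc ?ImMc /=.
  under eq_Rintegral do rewrite ReMc.
  by rewrite RintegralB ?RintegralZl//; exact: integrableZR.
under eq_Rintegral do rewrite ImMc.
by rewrite RintegralD ?RintegralZl//; exact: integrableZR.
Qed.

Lemma cintegrable0 D : measurable D -> cintegrable D (fun=> 0).
Proof. by move=> mD; apply/cintegrableP => //; split; exact: integrable0. Qed.

Lemma cint0 D : cint D (fun=> 0) = 0.
Proof. by rewrite /cint /Rintegral /= integral0. Qed.

End cint.

Section csum.
Context {R : realType}.
Implicit Types (D : set int) (F G : int -> R[i]) (c : R[i]).

Lemma csummable_Re D F : csummable D F ->
  (\esum_(n in D) (`|complex.Re (F n)|)%:E < +oo)%E.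
Proof.
by apply: le_lt_trans; apply: le_esum => n _; rewrite lee_fin normc_geRe.
Qed.

Lemma csummable_Im D F : csummable D F ->
  (\esum_(n in D) (`|complex.Im (F n)|)%:E < +oo)%E.
Proof.
by apply: le_lt_trans; apply: le_esum => n _; rewrite lee_fin normc_geIm.
Qed.

Lemma eq_csum D F G : (forall n, D n -> F n = G n) -> csum D F = csum D G.
Proof.
by move=> FG; rewrite /csum; congr (_ +i* _); apply: eq_rsum => n Dn; rewrite FG.
Qed.

Lemma le_csummable D F G : (forall n, D n -> normc (F n) <= normc (G n)) ->
  csummable D G -> csummable D F.
Proof.
by move=> FG; apply: le_lt_trans; apply: le_esum => n Dn; rewrite lee_fin FG.
Qed.

Lemma csummableZ D c F : csummable D F -> csummable D (fun n => c * F n).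
Proof.
move=> sF; rewrite /csummable; under eq_esum do rewrite normcM EFinM.
rewrite esumZl ?normc_ge0// => [|n _]; last by rewrite lee_fin normc_ge0.
by apply: lte_mul_pinfty; rewrite ?lee_fin ?normc_ge0.
Qed.

Lemma csumZ D c F : csummable D F -> csum D (fun n => c * F n) = c * csum D F.
Proof.
move=> sF; have sr := csummable_Re sF; have si := csummable_Im sF.
apply: eq_complexP; rewrite ?ReMc ?ImMc /=.
  rewrite (eq_rsum (G := fun n => complex.Re c * complex.Re (F n) +
      (- complex.Im c) * complex.Im (F n))); last first.
    by move=> n _; rewrite ReMc mulNr.
  by rewrite rsumD ?rsumZ// ?mulNr//; exact: summableRZ.
rewrite (eq_rsum (G := fun n => complex.Re c * complex.Im (F n) +
    complex.Im c * complex.Re (F n))); last by move=> n _; rewrite ImMc.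
by rewrite rsumD ?rsumZ//; exact: summableRZ.
Qed.

Variables (E : set R) (mE : measurable E) (D : set int) (F : int -> R -> R[i]).
Hypothesis mReF : forall n, D n -> measurable_fun E (fun x => complex.Re (F n x)).
Hypothesis mImF : forall n, D n -> measurable_fun E (fun x => complex.Im (F n x)).
Hypothesis iF : (\esum_(n in D)
  \int[lebesgue_measure]_(x in E) (normc (F n x))%:E < +oo)%E.
Hypothesis sF : forall x, E x -> csummable D (F ^~ x).

Let iR : (\esum_(n in D)
  \int[lebesgue_measure]_(x in E) (`|complex.Re (F n x)|)%:E < +oo)%E.
Proof.
apply: le_lt_trans iF; apply: le_esum => n Dn; apply: ge0_le_integral => //.
- by apply/measurable_EFinP; apply: measurableT_comp => //; exact: mReF.
- by apply/measurable_EFinP; apply: measurable_normc; [exact: mReF|exact: mImF].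
- by move=> x _; rewrite lee_fin normc_geRe.
Qed.

Let iI : (\esum_(n in D)
  \int[lebesgue_measure]_(x in E) (`|complex.Im (F n x)|)%:E < +oo)%E.
Proof.
apply: le_lt_trans iF; apply: le_esum => n Dn; apply: ge0_le_integral => //.
- by apply/measurable_EFinP; apply: measurableT_comp => //; exact: mImF.
- by apply/measurable_EFinP; apply: measurable_normc; [exact: mReF|exact: mImF].
- by move=> x _; rewrite lee_fin normc_geIm.
Qed.

Let fR n x := complex.Re (F n x).
Let fI n x := complex.Im (F n x).

Lemma cintegrable_csum : cintegrable E (fun x => csum D (F ^~ x)).
Proof.
apply/cintegrableP => //; split.
  by apply: (@integrable_rsum _ _ R lebesgue_measure E mE D fR mReF iR) => x Ex;
    exact: csummable_Re (sF Ex).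
by apply: (@integrable_rsum _ _ R lebesgue_measure E mE D fI mImF iI) => x Ex;
  exact: csummable_Im (sF Ex).
Qed.

Lemma cint_csum : cint E (fun x => csum D (F ^~ x)) = csum D (fun n => cint E (F n)).
Proof.
apply: eq_complexP => /=.
  by apply: (@Rintegral_rsum _ _ R lebesgue_measure E mE D fR mReF iR) => x Ex;
    exact: csummable_Re (sF Ex).
by apply: (@Rintegral_rsum _ _ R lebesgue_measure E mE D fI mImF iI) => x Ex;
  exact: csummable_Im (sF Ex).
Qed.

End csum.

(** * Fubini on a product of measurable sets *)

Section fubini_restricted.
Context {d1 d2 : measure_display} {T1 : measurableType d1} {T2 : measurableType d2}.
Context {R : realType}.
Variables (m1 : {sigma_finite_measure set T1 -> \bar R}).
Variables (m2 : {sigma_finite_measure set T2 -> \bar R}).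
Variables (E1 : set T1) (E2 : set T2) (mE1 : measurable E1) (mE2 : measurable E2).

(** Extension by zero outside the rectangle makes the theorems on the full product applicable;
    [cut12] and [cut21] say that its partial integrals are again extensions by zero. *)
Let cut (h : T1 * T2 -> \bar R) := h \_ (E1 `*` E2).

Let cut12 h x : (\int[m2]_y cut h (x, y) =
  ((fun x => \int[m2]_(y in E2) h (x, y)) \_ E1) x)%E.
Proof.
rewrite patchE; case: ifPn => [/set_mem xE|/negP xE].
  rewrite [RHS]integral_mkcond; apply: eq_integral => y _.
  rewrite /cut !patchE; congr (if _ then _ else _).
  by apply/idP/idP => /set_mem yE; apply/mem_set => //; case: yE.
rewrite integral0_eq// => y _; rewrite /cut patchE ifF//.
by apply/negP => /set_mem [/= xE' _]; apply: xE; exact/mem_set.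
Qed.

Let cut21 h y : (\int[m1]_x cut h (x, y) =
  ((fun y => \int[m1]_(x in E1) h (x, y)) \_ E2) y)%E.
Proof.
rewrite patchE; case: ifPn => [/set_mem yE|/negP yE].
  rewrite [RHS]integral_mkcond; apply: eq_integral => x _.
  rewrite /cut !patchE; congr (if _ then _ else _).
  by apply/idP/idP => /set_mem xE; apply/mem_set => //; case: xE.
rewrite integral0_eq// => x _; rewrite /cut patchE ifF//.
by apply/negP => /set_mem [/= _ yE']; apply: yE; exact/mem_set.
Qed.

Let mcut h : measurable_fun (E1 `*` E2) h -> measurable_fun setT (cut h).
Proof. by move=> mh; apply/(measurable_restrictT _ _).1 => //; exact: measurableX. Qed.

Lemma tonelli_restricted (h : T1 * T2 -> \bar R) :
  measurable_fun (E1 `*` E2) h -> (forall z, (0 <= h z)%E) ->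
  (\int[m1]_(x in E1) \int[m2]_(y in E2) h (x, y) =
   \int[m2]_(y in E2) \int[m1]_(x in E1) h (x, y))%E.
Proof.
move=> mh h0.
rewrite integral_mkcond [RHS]integral_mkcond.
under eq_integral do rewrite -cut12.
under [RHS]eq_integral do rewrite -cut21.
apply: fubini_tonelli; first exact: mcut.
by move=> z; rewrite /cut patchE; case: ifP.
Qed.

Lemma measurable_integral_restricted (h : T1 * T2 -> \bar R) :
  measurable_fun (E1 `*` E2) h -> (forall z, (0 <= h z)%E) ->
  measurable_fun E1 (fun x => \int[m2]_(y in E2) h (x, y))%E.
Proof.
move=> mh h0; apply/(measurable_restrictT _ mE1).2.
have -> : ((fun x => \int[m2]_(y in E2) h (x, y)) \_ E1 =
    fun x => \int[m2]_y cut h (x, y))%E by apply/funext => x; rewrite cut12.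
apply: measurable_fun_fubini_tonelli_F; first exact: mcut.
by move=> z; rewrite /cut patchE; case: ifP.
Qed.

Variable h : T1 -> T2 -> R.
Hypothesis mh : measurable_fun (E1 `*` E2) (fun z => h z.1 z.2).
Hypothesis i1 : forall x, E1 x -> m2.-integrable E2 (EFin \o h x).
Hypothesis i2 : forall y, E2 y -> m1.-integrable E1 (EFin \o (h ^~ y)).
Hypothesis hoo : (\int[m1]_(x in E1) \int[m2]_(y in E2) (`|h x y|)%:E < +oo)%E.

Let hE (z : T1 * T2) := (h z.1 z.2)%:E.

Let icut : (m1 \x m2)%E.-integrable setT (cut hE).
Proof.
apply/integrable12ltyP; first by apply: mcut; exact/measurable_EFinP.
apply: le_lt_trans hoo.
rewrite [leRHS]integral_mkcond le_eqVlt; apply/orP; left; apply/eqP.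
apply: eq_integral => x _.
rewrite -(cut12 (fun z => (`|h z.1 z.2|)%:E)).
by apply: eq_integral => y _; rewrite /cut !patchE; case: ifP; rewrite ?abse0.
Qed.

(** Integrability of every section, rather than of almost every one, makes the [fine] in the inner
    integral exact at each point. *)
Let fin1 x : E1 x -> (\int[m2]_(y in E2) h x y)%:E = (\int[m2]_(y in E2) hE (x, y))%E.
Proof. by move=> E1x; rewrite /Rintegral fineK//; exact: integrable_fin_num (i1 E1x). Qed.

Let fin2 y : E2 y -> (\int[m1]_(x in E1) h x y)%:E = (\int[m1]_(x in E1) hE (x, y))%E.
Proof. by move=> E2y; rewrite /Rintegral fineK//; exact: integrable_fin_num (i2 E2y). Qed.

Let int1 : (EFin \o (fun x => \int[m2]_(y in E2) h x y)) \_ E1 =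
  (fun x => \int[m2]_y cut hE (x, y))%E.
Proof.
apply/funext => x; rewrite cut12 !patchE; case: ifP => // /set_mem E1x.
by rewrite /comp fin1.
Qed.

Let int2 : (EFin \o (fun y => \int[m1]_(x in E1) h x y)) \_ E2 =
  (fun y => \int[m1]_x cut hE (x, y))%E.
Proof.
apply/funext => y; rewrite cut21 !patchE; case: ifP => // /set_mem E2y.
by rewrite /comp fin2.
Qed.

Lemma integrable_Rintegral1 :
  m1.-integrable E1 (EFin \o (fun x => \int[m2]_(y in E2) h x y)).
Proof.
rewrite integrable_mkcond// int1; exact: (integrable_fubini_F icut).
Qed.

Lemma Fubini_Rintegral :
  \int[m1]_(x in E1) \int[m2]_(y in E2) h x y =
  \int[m2]_(y in E2) \int[m1]_(x in E1) h x y.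
Proof.
rewrite /Rintegral; congr fine.
rewrite integral_mkcond [RHS]integral_mkcond.
rewrite -![fun x => (fine _)%:E]/(EFin \o _).
rewrite int1 int2; exact: Fubini.
Qed.

End fubini_restricted.

Section measurable_comp.
Context {d : measure_display} {T : measurableType d} {R : realType}.
Implicit Types (D : set T) (f : T -> R).

Lemma measurable_fun_expR D f : measurable_fun D f ->
  measurable_fun D (fun x => expR (f x)).
Proof. by move=> mf; apply: measurableT_comp mf; exact: measurable_expR. Qed.

Lemma measurable_fun_powR D f (p : R) : measurable_fun D f ->
  measurable_fun D (fun x => f x `^ p).
Proof.
by move=> mf; apply: (measurableT_comp (measurable_powR p) mf).
Qed.

Lemma measurable_funZ D f (c : R) : measurable_fun D f ->
  measurable_fun D (fun x => c * f x).
Proof. by move=> mf; exact: measurable_funM. Qed.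

End measurable_comp.

(** * The substitution in the incomplete gamma integral *)

Section inc_gamma.
Context {R : realType}.
Notation mu := (@lebesgue_measure R).

Lemma integral_inc_gamma (a w : R) : 0 < w ->
  (\int[mu]_(t in `]w, +oo[) (expR (- t) * t `^ (a - 1))%:E =
   \int[mu]_(t in @posreal R)
     (w `^ a * expR (- w) * (expR (- (w * t)) * (1 + t) `^ (a - 1)))%:E)%E.
Proof.
move=> w0.
pose G (t : R) : R := expR (- t) * t `^ (a - 1).
pose F (x : R) : R := w * (1 + x).
have dF (x : R) : is_derive x 1 F w.
  have : is_derive x (1 : R) (w *: (cst 1 + id : R -> R)) (w *: (0 + 1)).
    by apply: is_deriveZ; apply: is_deriveD.
  by rewrite add0r /GRing.scale /= mulr1.
have F' : F^`()%classic = cst w.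
  by apply/funext => x; rewrite derive1E; exact: derive_val.
have cG (x : R) : 0 < x -> {for x, continuous G}.
  move=> x0; apply: continuousM.
    apply: continuous_comp; first exact: continuousN.
    exact: continuous_expR.
  by apply: differentiable_continuous; apply/derivable1_diffP;
    apply: ex_derive; exact: is_derive1_powR.
have mG (D : set R) : measurable_fun D G.
  apply: measurable_funM; last exact: measurable_fun_powR.
  by apply: measurable_fun_expR; exact: measurable_funN.
have F0 : F 0 = w by rewrite /F addr0 mulr1.
have sub : (\int[mu]_(x in `[w, +oo[) (G x)%:E =
    \int[mu]_(x in `[0%R, +oo[) (((G \o F) * F^`()%classic) x)%:E)%E.
  rewrite -[in LHS]F0; apply: increasing_ge0_integration_by_substitutiony.
  - by move=> x y _ _ xy; rewrite ltr_pM2l// ltrD2l.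
  - by move=> x _; rewrite F'; exact: cst_continuous.
  - by rewrite F'; exact: is_cvg_cst.
  - by rewrite F'; exact: is_cvg_cst.
  - split=> [x _|]; first by apply: ex_derive.
    apply: cvg_at_right_filter; apply: differentiable_continuous.
    by apply/derivable1_diffP; apply: ex_derive.
  - apply/cvgryPge => A; near=> x.
    rewrite /F mulrC -ler_pdivrMr//.
    have Ax : A / w <= x by near: x; apply: nbhs_pinfty_ge; rewrite num_real.
    by rewrite (le_trans Ax)// lerDr.
  - rewrite F0; apply: continuous_in_subspaceT => x.
    by rewrite inE /= in_itv /= andbT => wx; apply: cG; exact: lt_le_trans wx.
  - by move=> x _; rewrite mulr_ge0 ?expR_ge0 ?powR_ge0.
(* The substitution is made on closed half-lines; the endpoint is a null set, so both sides may be
   passed to closed intervals. *)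
rewrite integral_itv_obnd_cbnd; last by apply/measurable_EFinP; exact: mG.
rewrite -/(G _) sub /posreal integral_itv_obnd_cbnd; last first.
  apply/measurable_EFinP; apply: measurable_funZ; apply: measurable_funM.
    by apply: measurable_fun_expR; apply: measurable_funN; exact: measurable_funZ.
  by apply: measurable_fun_powR; exact: measurable_funD.
apply: eq_integral => x /set_mem /=; rewrite in_itv /= andbT => x0.
rewrite F'; congr EFin.
rewrite -[LHS]/(expR (- (w * (1 + x))) * (w * (1 + x)) `^ (a - 1) * w).
have x1 : 0 <= 1 + x by rewrite addr_ge0.
rewrite powRM ?(ltW w0)// mulrDr mulr1 opprD expRD.
(* The extra factor [w] is the Jacobian; the other power of [w] comes out of
   [(w * (1 + x)) ^ (a - 1)]. *)
have -> : w `^ a = w * w `^ (a - 1).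
  by rewrite -{2}(powRr1 (ltW w0)) -powRD ?subrKC// (gt_eqF w0) implybT.
rewrite /cst; ring.
Unshelve. all: by end_near. Qed.

End inc_gamma.

(** * The incomplete gamma kernel *)

Section incomplete_gamma_kernel.
Context {R : realType}.
Notation mu := (@lebesgue_measure R).
Notation E := (@posreal R).

Lemma measurable_posreal : measurable E.
Proof. exact: measurable_itv. Qed.
Local Hint Resolve measurable_posreal : core.

Lemma posrealP (x : R) : E x <-> 0 < x.
Proof. by rewrite /posreal /= in_itv /= andbT. Qed.

(** Apply [ln X <= X - 1] to [X = e (1 + t)] with [e = c / q] and multiply by [q]: since [q e = c],
    this bounds [q ln (1 + t)] by [c t + q (e - ln e)]. Taking [q = |p| + 1] keeps [q] positive when
    [p = 0]. *)
Lemma powR_1D_le_expR (c p t : R) : 0 < c -> 0 < t ->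
  (1 + t) `^ p <=
  expR ((`|p| + 1) * (c / (`|p| + 1) - ln (c / (`|p| + 1)))) * expR (c * t).
Proof.
move=> c0 t0; set q := `|p| + 1; set e := c / q.
have q0 : 0 < q by rewrite ltr_wpDl.
have e0 : 0 < e by rewrite divr_gt0.
have t1 : 0 < 1 + t by rewrite addr_gt0.
have l0 : 0 <= ln (1 + t) by rewrite ln_ge0// lerDl ltW.
rewrite /powR gt_eqF// -expRD ler_expR.
have : ln (e * (1 + t)) <= e * (1 + t) - 1.
  have := @le_ln1Dx R (e * (1 + t) - 1); rewrite subrKC; apply.
  by rewrite ltrBrDl subrr mulr_gt0.
rewrite lnM ?posrealE// => h.
have -> : c = q * e by rewrite /e mulrC divfK// gt_eqF.
apply: (@le_trans _ _ (q * ln (1 + t))).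
  by rewrite ler_wpM2r// (le_trans (ler_norm _))// /q lerDl.
by rewrite -mulrA -mulrDr ler_wpM2l ?(ltW q0)//; lra.
Qed.

(** Half of the decay rate absorbs the power of [1 + t]; the other half leaves a multiple of an
    exponential density, which is integrable. *)
Lemma integrable_expR_powR (c p : R) : 0 < c ->
  mu.-integrable E (fun t => (expR (- (c * t)) * (1 + t) `^ p)%:E).
Proof.
move=> c0; set d := c / 2; have d0 : 0 < d by rewrite divr_gt0.
pose C := expR ((`|p| + 1) * (d / (`|p| + 1) - ln (d / (`|p| + 1)))).
have i0 : mu.-integrable E (EFin \o exponential_pdf d).
  by apply: integrableS (integrable_exponential_pdf d0).
have i1 : mu.-integrable E (fun t => (C / d)%:E * (exponential_pdf d t)%:E)%E.
  exact: integrableZl.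
apply: le_integrable i1 => //.
  apply/measurable_EFinP; apply: measurable_funM.
    by apply: measurable_fun_expR; apply: measurable_funN; exact: measurable_funZ.
  by apply: measurable_fun_powR; exact: measurable_funD.
move=> t /posrealP t0; rewrite -EFinM !abse_EFin lee_fin.
have -> : exponential_pdf d t = d * expR (- d * t).
  by rewrite exponential_pdfE ?ltW.
rewrite ger0_norm ?mulr_ge0 ?expR_ge0 ?powR_ge0// (le_trans _ (ler_norm _))//.
have -> : C / d * (d * expR (- d * t)) = C * expR (- d * t).
  by field; rewrite gt_eqF.
rewrite (le_trans (ler_wpM2l (expR_ge0 _) (powR_1D_le_expR p d0 t0)))//.
rewrite -/C mulrCA ler_wpM2l ?expR_ge0// -expRD ler_expR /d; lra.
Qed.

Lemma inc_gammaE (a w : R) : 0 < w ->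
  inc_gamma a w = w `^ a * expR (- w) *
    \int[mu]_(t in E) (expR (- (w * t)) * (1 + t) `^ (a - 1)).
Proof.
move=> w0; rewrite -RintegralZl//; last exact: integrable_expR_powR.
by rewrite /inc_gamma /Rintegral integral_inc_gamma.
Qed.

Definition gamma_kernel (k b y t : R) : R :=
  y `^ (1 - k) * expR (- (b * (2 * t + 1) * y)) * (1 + t) `^ (- k).

Lemma gamma_kernel_ge0 k b y t : 0 <= gamma_kernel k b y t.
Proof. by rewrite !mulr_ge0 ?expR_ge0 ?powR_ge0. Qed.

Lemma gamma_kernelE k b y t : gamma_kernel k b y t =
  y `^ (1 - k) * expR (- (b * y)) * (expR (- (2 * b * y * t)) * (1 + t) `^ (- k)).
Proof.
have e : expR (- (b * (2 * t + 1) * y)) = expR (- (b * y)) * expR (- (2 * b * y * t)).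
  by rewrite -expRD; congr expR; ring.
by rewrite /gamma_kernel e; ring.
Qed.

Lemma integrable_gamma_kernel k b y : 0 < b -> 0 < y ->
  mu.-integrable E (EFin \o gamma_kernel k b y).
Proof.
move=> b0 y0.
have i : mu.-integrable E (fun t => (y `^ (1 - k) * expR (- (b * y)))%:E *
    (expR (- (2 * b * y * t)) * (1 + t) `^ (- k))%:E)%E.
  by apply: integrableZl => //; apply: integrable_expR_powR; rewrite !mulr_gt0.
by apply: eq_integrable i => // t _; rewrite /= gamma_kernelE.
Qed.

Lemma inc_gamma_kernel k b y : 0 < b -> 0 < y ->
  inc_gamma (1 - k) (2 * b * y) * expR (b * y) =
  (2 * b) `^ (1 - k) * \int[mu]_(t in E) gamma_kernel k b y t.
Proof.
move=> b0 y0; have w0 : 0 < 2 * b * y by rewrite !mulr_gt0.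
under [in RHS]eq_Rintegral do rewrite gamma_kernelE.
rewrite RintegralZl//; last exact: integrable_expR_powR.
rewrite inc_gammaE// powRM ?(ltW y0) ?mulr_ge0 ?(ltW b0)//.
rewrite (_ : 1 - k - 1 = - k); last by ring.
have -> : expR (- (b * y)) = expR (- (2 * b * y)) * expR (b * y).
  by rewrite -expRD; congr expR; ring.
ring.
Qed.

Let measurable_kernel (p : R -> R) k b : measurable_fun E p ->
  measurable_fun (E `*` E) (fun z => p z.1 * gamma_kernel k b z.1 z.2).
Proof.
move=> mp; apply: measurable_funM.
  apply: (measurable_comp (F := E)) mp _ => //; last exact: measurable_funTS.
  by move=> _ [z [? ?] <-].
have m1 : measurable_fun (E `*` E) (fst : R * R -> R) by exact: measurable_funTS.
have m2 : measurable_fun (E `*` E) (snd : R * R -> R) by exact: measurable_funTS.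
apply: measurable_funM; last first.
  by apply: measurable_fun_powR; exact: measurable_funD.
apply: measurable_funM; first exact: measurable_fun_powR.
apply: measurable_fun_expR; apply: measurable_funN.
apply: measurable_funM => //; apply: measurable_funZ; apply: measurable_funD => //.
exact: measurable_funZ.
Qed.

Let measurable_laplace_integrand (p : R -> R) k s : measurable_fun E p ->
  measurable_fun E (fun y => expR (- (s * y)) * (p y * y `^ (1 - k))).
Proof.
move=> mp; apply: measurable_funM.
  by apply: measurable_fun_expR; apply: measurable_funN; exact: measurable_funZ.
by apply: measurable_funM => //; exact: measurable_fun_powR.
Qed.

Lemma tonelli_gamma_kernel (p : R -> R) k b : measurable_fun E p ->
  (forall y, 0 <= p y) ->
  (\int[mu]_(y in E) \int[mu]_(t in E) (p y * gamma_kernel k b y t)%:E =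
   \int[mu]_(t in E)
     (\int[mu]_(y in E) (expR (- (b * (2 * t + 1) * y)) * (p y * y `^ (1 - k)))%:E
      * (((1 + t) `^ k)^-1)%:E))%E.
Proof.
move=> mp p0; have mk := measurable_kernel k b mp.
rewrite (@tonelli_restricted _ _ _ _ _ mu mu E E _ _
  (fun z => (p z.1 * gamma_kernel k b z.1 z.2)%:E))//; last first.
- by move=> z; rewrite lee_fin mulr_ge0 ?gamma_kernel_ge0.
- exact/measurable_EFinP.
apply: eq_integral => t _; rewrite -ge0_integralZr//.
- apply: eq_integral => y _; rewrite -EFinM /gamma_kernel -powRN.
  by congr EFin; ring.
- by apply/measurable_EFinP; exact: measurable_laplace_integrand.
- by move=> y _; rewrite lee_fin !mulr_ge0 ?expR_ge0 ?powR_ge0.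
- by rewrite lee_fin invr_ge0 powR_ge0.
Qed.

(** An identity in [0, +oo], free of convergence assumptions. It is therefore the tool that converts
    finiteness of the double Laplace integral into integrability against the gamma weight. *)
Lemma integral_inc_gamma_ge0 (p : R -> R) k b : 0 < b -> measurable_fun E p ->
  (forall y, 0 <= p y) ->
  (\int[mu]_(y in E) (inc_gamma (1 - k) (2 * b * y) * expR (b * y) * p y)%:E =
   ((2 * b) `^ (1 - k))%:E * \int[mu]_(t in E)
     (\int[mu]_(y in E) (expR (- (b * (2 * t + 1) * y)) * (p y * y `^ (1 - k)))%:E
      * (((1 + t) `^ k)^-1)%:E))%E.
Proof.
move=> b0 mp p0; rewrite -tonelli_gamma_kernel//.
rewrite -ge0_integralZl//; last first.
- by rewrite lee_fin powR_ge0.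
- by move=> y _; apply: integral_ge0 => t _; rewrite lee_fin mulr_ge0 ?gamma_kernel_ge0.
- apply: (@measurable_integral_restricted _ _ _ _ _ mu E E _ _
    (fun z => (p z.1 * gamma_kernel k b z.1 z.2)%:E)) => //.
    by apply/measurable_EFinP; exact: measurable_kernel.
  by move=> z; rewrite lee_fin mulr_ge0 ?gamma_kernel_ge0.
apply: eq_integral => y /set_mem /posrealP y0.
under eq_integral do rewrite EFinM.
rewrite integralZl//; last exact: integrable_gamma_kernel.
have /fineK <- : (\int[mu]_(t in E) (gamma_kernel k b y t)%:E)%E \is a fin_num.
  by apply: integrable_fin_num => //; exact: integrable_gamma_kernel.
by rewrite inc_gamma_kernel// -!EFinM -/(Rintegral _ _ _); congr EFin; ring.
Qed.

(** The kernel formula exhibits the weight as a parameter integral of a jointly measurable function.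
    The factor 1 is the weight [p] in [measurable_kernel]. *)
Lemma measurable_inc_gamma k b : 0 < b ->
  measurable_fun E (fun y => inc_gamma (1 - k) (2 * b * y) * expR (b * y)).
Proof.
move=> b0; apply: (eq_measurable_fun (fun y => (2 * b) `^ (1 - k) *
    fine (\int[mu]_(t in E) (1 * gamma_kernel k b y t)%:E)%E)).
  move=> y /set_mem /posrealP y0; rewrite inc_gamma_kernel// /Rintegral.
  by congr (_ * fine _); apply: eq_integral => t _; rewrite mul1r.
apply: measurable_funZ; apply: measurableT_comp => //.
apply: (@measurable_integral_restricted _ _ _ _ _ mu E E _ _
    (fun z => (1 * gamma_kernel k b z.1 z.2)%:E)) => //.
  by apply/measurable_EFinP; apply: (measurable_kernel (p := cst 1)).
by move=> z; rewrite lee_fin mul1r gamma_kernel_ge0.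
Qed.

Lemma inc_gamma_ge0 (a w : R) : 0 <= inc_gamma a w.
Proof. by apply: Rintegral_ge0 => t _; rewrite mulr_ge0 ?expR_ge0 ?powR_ge0. Qed.

Section signed.
Variables (p : R -> R) (k b : R) (b0 : 0 < b) (mp : measurable_fun E p).
Hypothesis p_laplace : forall s, 0 < s ->
  mu.-integrable E (EFin \o (fun y => expR (- (s * y)) * (p y * y `^ (1 - k)))).
Hypothesis poo : (\int[mu]_(t in E)
  (\int[mu]_(y in E) (expR (- (b * (2 * t + 1) * y)) * (`|p y| * y `^ (1 - k)))%:E
   * (((1 + t) `^ k)^-1)%:E) < +oo)%E.

Let h y t := p y * gamma_kernel k b y t.

Let mh : measurable_fun (E `*` E) (fun z => h z.1 z.2).
Proof. exact: measurable_kernel. Qed.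

Let i1 y : E y -> mu.-integrable E (EFin \o h y).
Proof.
move=> /posrealP y0.
suff : mu.-integrable E (fun t => (p y)%:E * (gamma_kernel k b y t)%:E)%E by [].
by apply: integrableZl => //; exact: integrable_gamma_kernel.
Qed.

Let hE y t : h y t = (expR (- (b * (2 * t + 1) * y)) * (p y * y `^ (1 - k))) *
  ((1 + t) `^ k)^-1.
Proof. by rewrite /h /gamma_kernel -powRN; ring. Qed.

Let st0 t : E t -> 0 < b * (2 * t + 1).
Proof. by move=> /posrealP t0; rewrite mulr_gt0// addr_gt0// mulr_gt0. Qed.

Let i2 t : E t -> mu.-integrable E (EFin \o (h ^~ t)).
Proof.
move=> t0; have i := p_laplace (st0 t0).
have j : mu.-integrable E (fun y => (expR (- (b * (2 * t + 1) * y)) *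
    (p y * y `^ (1 - k)))%:E * (((1 + t) `^ k)^-1)%:E)%E by exact: integrableZr.
by apply: eq_integrable j => // y _; rewrite /= hE.
Qed.

Let hoo : (\int[mu]_(y in E) \int[mu]_(t in E) (`|h y t|)%:E < +oo)%E.
Proof.
have := poo; rewrite -(@tonelli_gamma_kernel (fun y => `|p y|))//; last first.
  exact: measurableT_comp.
apply: le_lt_trans; rewrite le_eqVlt; apply/orP; left; apply/eqP.
apply: eq_integral => y _; apply: eq_integral => t _.
by rewrite /h normrM (ger0_norm (gamma_kernel_ge0 _ _ _ _)).
Qed.

Let gammaE y : E y -> inc_gamma (1 - k) (2 * b * y) * expR (b * y) * p y =
  (2 * b) `^ (1 - k) * \int[mu]_(t in E) h y t.
Proof.
move=> /posrealP y0; rewrite inc_gamma_kernel// RintegralZl//; first by ring.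
exact: integrable_gamma_kernel.
Qed.

Let iG : mu.-integrable E (EFin \o (fun y => \int[mu]_(t in E) h y t)).
Proof. exact: (@integrable_Rintegral1 _ _ _ _ _ mu mu). Qed.

(** Fubini for a weight [p] of any sign: [p_laplace] at [s = b (2 t + 1)] gives integrability in [y]
    for each [t], the decay of the kernel gives it in [t] for each [y], and [poo] is absolute
    convergence on the product. *)
Lemma Rintegral_inc_gamma :
  \int[mu]_(y in E) (inc_gamma (1 - k) (2 * b * y) * expR (b * y) * p y) =
  (2 * b) `^ (1 - k) * \int[mu]_(t in E)
    ((\int[mu]_(y in E) (expR (- (b * (2 * t + 1) * y)) * (p y * y `^ (1 - k))))
     * ((1 + t) `^ k)^-1).
Proof.
transitivity (\int[mu]_(y in E) ((2 * b) `^ (1 - k) * \int[mu]_(t in E) h y t)).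
  by apply: eq_Rintegral => y /set_mem Ey; exact: gammaE.
rewrite RintegralZl//; congr (_ * _).
rewrite (@Fubini_Rintegral _ _ _ _ _ mu mu)//.
apply: eq_Rintegral => t /set_mem Et.
rewrite -RintegralZr//; last exact: p_laplace (st0 Et).
by apply: eq_Rintegral => y _; rewrite hE.
Qed.

End signed.

End incomplete_gamma_kernel.

(** * Laplace transforms at real points *)

Section laplace_real.
Context {R : realType}.
Notation mu := (@lebesgue_measure R).
Notation E := (@posreal R).
Let measurable_posrealR : measurable (E : set (measurableTypeR R)).
Proof. exact: measurable_posreal. Qed.
Local Hint Resolve measurable_posreal measurable_posrealR : core.

Lemma cexp_real (r : R) : cexp r%:C = (expR r)%:C.
Proof. by rewrite /cexp /= cos0 sin0 mulr1 mulr0. Qed.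

Lemma cexp_laplace (s t : R) : cexp (- (s%:C * t%:C)) = (expR (- (s * t)))%:C.
Proof. by rewrite -cexp_real rmorphN rmorphM. Qed.

Lemma laplaceE (phi : R -> R[i]) (s : R) :
  laplace phi s%:C = cint E (fun t => (expR (- (s * t)))%:C * phi t).
Proof. by apply: eq_cint => t _; rewrite cexp_laplace. Qed.

Lemma laplace_abscvgE (phi : R -> R[i]) (s : R) : laplace_abscvg phi s%:C ->
  cintegrable E (fun t => (expR (- (s * t)))%:C * phi t).
Proof. by apply: eq_cintegrable => t _; rewrite cexp_laplace. Qed.

Let real_complexV (r : R) : (r%:C)^-1 = (r^-1)%:C.
Proof. by rewrite [RHS](fmorphV (real_complex R)). Qed.

Let Re_divC z (r : R) : complex.Re (z / r%:C) = complex.Re z * r^-1.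
Proof. by rewrite real_complexV mulrC ReZc mulrC. Qed.

Let Im_divC z (r : R) : complex.Im (z / r%:C) = complex.Im z * r^-1.
Proof. by rewrite real_complexV mulrC ImZc mulrC. Qed.

Lemma eq_laplace (phi psi : R -> R[i]) s : (forall x, 0 < x -> phi x = psi x) ->
  laplace phi s = laplace psi s.
Proof. by move=> e; apply: eq_cint => t /posrealP t0; rewrite e. Qed.

Lemma eq_laplace_abscvg (phi psi : R -> R[i]) s :
  (forall x, 0 < x -> phi x = psi x) ->
  laplace_abscvg phi s -> laplace_abscvg psi s.
Proof. by move=> e; apply: eq_cintegrable => t /posrealP t0; rewrite e. Qed.

Lemma eq_laplace_norm (phi psi : R -> R[i]) s :
  (forall x, 0 < x -> phi x = psi x) ->
  laplace_norm phi s = laplace_norm psi s.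
Proof.
by move=> e; apply: eq_integral => t /set_mem /posrealP t0; rewrite e.
Qed.

Lemma laplace_norm_ge0 (phi : R -> R[i]) s : (0 <= laplace_norm phi s)%E.
Proof.
by apply: integral_ge0 => t _; rewrite lee_fin mulr_ge0 ?expR_ge0 ?normc_ge0.
Qed.

Definition cmeasurable (phi : R -> R[i]) :=
  measurable_fun E (fun x => complex.Re (phi x)) /\
  measurable_fun E (fun x => complex.Im (phi x)).

Lemma cmeasurableZ (w : R -> R) phi : measurable_fun E w -> cmeasurable phi ->
  cmeasurable (fun x => (w x)%:C * phi x).
Proof.
move=> mw [mr mi]; split.
  by under eq_fun do rewrite ReZc; exact: measurable_funM.
by under eq_fun do rewrite ImZc; exact: measurable_funM.
Qed.

Lemma cmeasurableM c phi : cmeasurable phi -> cmeasurable (fun x => c * phi x).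
Proof.
move=> [mr mi]; split.
  under eq_fun do rewrite ReMc; apply: measurable_funB; exact: measurable_funZ.
under eq_fun do rewrite ImMc; apply: measurable_funD; exact: measurable_funZ.
Qed.

(** At [s = 0] the integrand is [phi] itself, and absolute convergence includes measurability. The
    point 0 lies in the half-plane of condition (i) because [n0 >= 0]. *)
Lemma laplace_abscvg_cmeasurable phi : laplace_abscvg phi 0 -> cmeasurable phi.
Proof.
move=> h; have /eq_cintegrable : forall t, E t -> cexp (- (0 * t%:C)) * phi t = phi t.
  by move=> t _; rewrite mul0r oppr0 (cexp_real 0) expR0 mul1r.
by move=> /(_ h)[].
Qed.

Lemma weighted_lty_cintegrable (e : R -> R) phi : cmeasurable phi ->
  measurable_fun E e -> (forall y, 0 <= e y) ->
  (\int[mu]_(y in E) (e y * normc (phi y))%:E < +oo)%E ->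
  cintegrable E (fun y => (e y)%:C * phi y).
Proof.
move=> mphi me e0 h.
have [mr mi] : cmeasurable (fun y => (e y)%:C * phi y) by exact: cmeasurableZ.
split => //; apply: le_lt_trans h; rewrite le_eqVlt; apply/orP; left; apply/eqP.
by apply: eq_integral => y _; rewrite normcM normcR ger0_norm.
Qed.

(** Common core of the holomorphic and nonholomorphic parts, which differ only in the nonnegative
    weights [e n]. *)
Lemma weighted_csum D (c : int -> R[i]) (e : int -> R -> R) (phi : R -> R[i]) :
  cmeasurable phi -> (forall n, D n -> measurable_fun E (e n)) ->
  (forall n y, 0 <= e n y) ->
  (\esum_(n in D) ((normc (c n))%:E *
     \int[mu]_(y in E) (e n y * normc (phi y))%:E) < +oo)%E ->
  (forall y, 0 < y -> csummable D (fun n => c n * (e n y)%:C)) ->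
  cintegrable E (fun y => csum D (fun n => c n * (e n y)%:C) * phi y) /\
  cint E (fun y => csum D (fun n => c n * (e n y)%:C) * phi y) =
  csum D (fun n => c n * cint E (fun y => (e n y)%:C * phi y)).
Proof.
move=> mphi me e0 phioo sc.
pose F n y := c n * ((e n y)%:C * phi y).
have mF n : D n -> cmeasurable (F n).
  by move=> Dn; apply: cmeasurableM; apply: cmeasurableZ => //; exact: me.
have mR n : D n -> measurable_fun E (fun y => complex.Re (F n y)) by case/mF.
have mI n : D n -> measurable_fun E (fun y => complex.Im (F n y)) by case/mF.
have Fphi y : F ^~ y = (fun n => phi y * (c n * (e n y)%:C)).
  by apply/funext => n; rewrite /F mulrA mulrC.
have sF y : E y -> csummable D (F ^~ y).
  by move=> /posrealP y0; rewrite Fphi; apply: csummableZ; exact: sc.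
have ephi0 n : (0 <= \int[mu]_(y in E) (e n y * normc (phi y))%:E)%E.
  by apply: integral_ge0 => y _; rewrite lee_fin mulr_ge0 ?normc_ge0.
have iF : (\esum_(n in D) \int[mu]_(y in E) (normc (F n y))%:E < +oo)%E.
  apply: le_lt_trans phioo; rewrite le_eqVlt; apply/orP; left; apply/eqP.
  apply: eq_esum => n Dn; rewrite -ge0_integralZl//.
  - apply: eq_integral => y _.
    by rewrite /F !normcM normcR (ger0_norm (e0 _ _)) EFinM.
  - apply/measurable_EFinP; apply: measurable_funM; first exact: me.
    by case: mphi => ? ?; exact: measurable_normc.
  - by move=> y _; rewrite lee_fin mulr_ge0 ?normc_ge0.
  - by rewrite lee_fin normc_ge0.
have eqF y : E y -> csum D (F ^~ y) = csum D (fun n => c n * (e n y)%:C) * phi y.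
  by move=> /posrealP y0; rewrite Fphi csumZ; [rewrite mulrC|exact: sc].
split.
  exact: (eq_cintegrable eqF (cintegrable_csum measurable_posreal mR mI iF sF)).
rewrite -(eq_cint eqF) (cint_csum measurable_posreal mR mI iF sF).
(* If [c n = 0], the summability hypothesis says nothing about the integral of [e n] against [phi],
   which may diverge; both sides are then 0. Otherwise a divergent integral would make this one
   summand infinite. *)
apply: eq_csum => n Dn; have [c0|c0] := eqVneq (c n) 0.
  by rewrite c0 mul0r -[RHS](cint0 E); apply: eq_cint => y _; rewrite /F c0 mul0r.
rewrite cintZ//; apply: weighted_lty_cintegrable => //; first exact: me.
have normc0 : 0 < normc (c n).
  by rewrite lt_neqAle normc_ge0 andbT eq_sym; apply: contra_neq c0; exact: eq0_normc.
have : ((normc (c n))%:E * \int[mu]_(y in E) (e n y * normc (phi y))%:E < +oo)%E.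
  apply: (@esum_lty_term _ _ D (fun n => (normc (c n))%:E *
    \int[mu]_(y in E) (e n y * normc (phi y))%:E)%E) => // i _.
  by rewrite mule_ge0// lee_fin normc_ge0.
rewrite !ltey; apply: contra_neq => ->.
by rewrite gt0_muley.
Qed.

Lemma plus_part (c : int -> R[i]) (la : int -> R) (phi : R -> R[i]) :
  cmeasurable phi ->
  (\esum_(n in [set: int]) ((normc (c n))%:E * laplace_norm phi (la n)) < +oo)%E ->
  (forall y, 0 < y -> csummable setT (fun n => c n * (expR (- (la n * y)))%:C)) ->
  cintegrable E (fun y => csum setT (fun n => c n * (expR (- (la n * y)))%:C) * phi y) /\
  cint E (fun y => csum setT (fun n => c n * (expR (- (la n * y)))%:C) * phi y) =
  csum setT (fun n => c n * laplace phi (la n)%:C).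
Proof.
move=> mphi phioo sc.
have [|n y||//|h1 h2] := @weighted_csum setT c (fun n y => expR (- (la n * y))) phi mphi.
- move=> n _; apply: measurable_fun_expR; apply: measurable_funN.
  exact: measurable_funZ.
- exact: expR_ge0.
- exact: phioo.
split; first exact: h1.
by apply: (etrans h2); apply: eq_csum => n _; rewrite laplaceE.
Qed.

Let twistE (phi : R -> R[i]) k y : twist phi (2 - k) y = (y `^ (1 - k))%:C * phi y.
Proof. by rewrite /twist mulrC (_ : 2 - k - 1 = 1 - k)//; ring. Qed.

(** Rewrites the factor attached to [c^-(n)] in condition (iii) as a weighted L^1 norm of [phi], the
    shape that [weighted_csum] takes. *)
Lemma normc_inc_gamma (phi : R -> R[i]) k b : 0 < b -> cmeasurable phi ->
  (\int[mu]_(y in E)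
     (inc_gamma (1 - k) (2 * b * y) * expR (b * y) * normc (phi y))%:E =
  ((2 * b) `^ (1 - k))%:E * \int[mu]_(t in E)
    (laplace_norm (twist phi (2 - k)) (b * (2 * t + 1)) * (((1 + t) `^ k)^-1)%:E))%E.
Proof.
move=> b0 [mr mi].
have mn : measurable_fun E (fun y => normc (phi y)) by exact: measurable_normc.
apply: (etrans (integral_inc_gamma_ge0 k b0 mn (fun y => normc_ge0 (phi y)))).
congr (_ * _)%E; apply: eq_integral => t _; congr (_ * _)%E.
apply: eq_integral => y _; rewrite twistE normcM normcR ger0_norm ?powR_ge0//.
by rewrite [normc _ * _]mulrC.
Qed.

Lemma cint_inc_gamma (phi : R -> R[i]) k b : 0 < b -> cmeasurable phi ->
  (forall s : R, 0 < s -> laplace_abscvg (twist phi (2 - k)) s%:C) ->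
  (\int[mu]_(t in E)
    (laplace_norm (twist phi (2 - k)) (b * (2 * t + 1)) * (((1 + t) `^ k)^-1)%:E)
   < +oo)%E ->
  cint E (fun y => (inc_gamma (1 - k) (2 * b * y) * expR (b * y))%:C * phi y) =
  ((2 * b) `^ (1 - k))%:C * cint E (fun t =>
    laplace (twist phi (2 - k)) (b * (2 * t + 1))%:C / ((1 + t) `^ k)%:C).
Proof.
move=> b0 [mr mi] lphi phioo.
(* The map [p] is the real or the imaginary part; only its homogeneity over the reals and its bound
   by the norm matter, so both are treated at once. *)
have ip (p : R[i] -> R) : (forall r z, p (r%:C * z) = r * p z) ->
    (forall z, `|p z| <= normc z) ->
    measurable_fun E (fun y => p (phi y)) ->
    (forall s : R, 0 < s -> mu.-integrable E
      (EFin \o (fun y => p ((expR (- (s * y)))%:C * twist phi (2 - k) y)))) ->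
  \int[mu]_(y in E) p ((inc_gamma (1 - k) (2 * b * y) * expR (b * y))%:C * phi y) =
  (2 * b) `^ (1 - k) * \int[mu]_(t in E)
    ((\int[mu]_(y in E) p ((expR (- (b * (2 * t + 1) * y)))%:C * twist phi (2 - k) y))
     * ((1 + t) `^ k)^-1).
  move=> pZ pn mp il.
  have mpn : measurable_fun E (fun y => `|p (phi y)|) by exact: measurableT_comp.
  have poo : (\int[mu]_(t in E)
      (\int[mu]_(y in E) (expR (- (b * (2 * t + 1) * y)) *
         (`|p (phi y)| * y `^ (1 - k)))%:E * (((1 + t) `^ k)^-1)%:E) < +oo)%E.
    (* The double integrals for [|p (phi y)|] and [normc (phi y)] are compared as single integrals
       against the gamma weight, where the inequality is pointwise in [y]; the positive factor
       [(2 b)^(1 - k)] is then cancelled. *)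
    have w0 : 0 < (2 * b) `^ (1 - k) by rewrite powR_gt0// mulr_gt0.
    have pmul_lty (X : \bar R) : (((2 * b) `^ (1 - k))%:E * X < +oo)%E -> (X < +oo)%E.
      by rewrite !ltey; apply: contra_neq => ->; rewrite gt0_muley.
    have XE := integral_inc_gamma_ge0 k b0 mpn (fun y => normr_ge0 (p (phi y))).
    apply: pmul_lty; rewrite -XE.
    have: (((2 * b) `^ (1 - k))%:E * \int[mu]_(t in E) (laplace_norm (twist phi (2 - k))
        (b * (2 * t + 1)) * (((1 + t) `^ k)^-1)%:E) < +oo)%E.
      by apply: lte_mul_pinfty phioo; rewrite ?lee_fin ?powR_ge0.
    apply: le_lt_trans.
    rewrite -(normc_inc_gamma k b0 (conj mr mi)).
    have mg := measurable_inc_gamma k b0.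
    apply: ge0_le_integral => //.
    - by move=> y _; rewrite lee_fin !mulr_ge0 ?inc_gamma_ge0 ?expR_ge0.
    - by apply/measurable_EFinP; exact: measurable_funM.
    - by apply/measurable_EFinP; apply: measurable_funM => //; exact: measurable_normc.
    - by move=> y _; rewrite lee_fin ler_wpM2l// mulr_ge0 ?inc_gamma_ge0 ?expR_ge0.
  have il' (s : R) : 0 < s -> mu.-integrable E
      (EFin \o (fun y => expR (- (s * y)) * (p (phi y) * y `^ (1 - k)))).
    move=> s0; apply: eq_integrable (il s s0) => // y _.
    by rewrite /= twistE !pZ [_ `^ _ * _]mulrC.
  apply: etrans (etrans (Rintegral_inc_gamma b0 mp il' poo) _).
    by apply: eq_Rintegral => y _; rewrite pZ.
  congr (_ * _); apply: eq_Rintegral => t _; congr (_ * _).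
  by apply: eq_Rintegral => y _; rewrite twistE !pZ [p _ * _]mulrC.
have lE (s : R) (s0 : 0 < s) := laplace_abscvgE (lphi s s0).
apply: eq_complexP; rewrite ?ReZc ?ImZc.
- apply: (etrans (ip _ ReZc normc_geRe mr _)).
    by move=> s s0; case/cintegrableP: (lE s s0).
  by congr (_ * _); apply: eq_Rintegral => t _; rewrite Re_divC laplaceE.
- apply: (etrans (ip _ ImZc normc_geIm mi _)).
    by move=> s s0; case/cintegrableP: (lE s s0).
  by congr (_ * _); apply: eq_Rintegral => t _; rewrite Im_divC laplaceE.
Qed.

End laplace_real.

(** * The nonholomorphic part and its decay in the frequency *)

Section minus_part.
Context {R : realType}.
Notation mu := (@lebesgue_measure R).
Notation E := (@posreal R).

Lemma minus_part D (c : int -> R[i]) (b : int -> R) (k : R) (phi : R -> R[i]) :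
  (forall n, D n -> 0 < b n) -> cmeasurable phi ->
  (forall s : R, 0 < s -> laplace_abscvg (twist phi (2 - k)) s%:C) ->
  (\esum_(n in D) ((normc (c n) * (2 * b n) `^ (1 - k))%:E *
     \int[mu]_(t in E) (laplace_norm (twist phi (2 - k)) (b n * (2 * t + 1))
       * (((1 + t) `^ k)^-1)%:E)) < +oo)%E ->
  let e n y := inc_gamma (1 - k) (2 * b n * y) * expR (b n * y) in
  (forall y, 0 < y -> csummable D (fun n => c n * (e n y)%:C)) ->
  cintegrable E (fun y => csum D (fun n => c n * (e n y)%:C) * phi y) /\
  cint E (fun y => csum D (fun n => c n * (e n y)%:C) * phi y) =
  csum D (fun n => c n * ((2 * b n) `^ (1 - k))%:C * cint E (fun t =>
    laplace (twist phi (2 - k)) (b n * (2 * t + 1))%:C / ((1 + t) `^ k)%:C)).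
Proof.
move=> b0 mphi lphi phioo e sc.
pose X n := (\int[mu]_(t in E) (laplace_norm (twist phi (2 - k)) (b n * (2 * t + 1))
       * (((1 + t) `^ k)^-1)%:E))%E.
have X0 n : (0 <= X n)%E.
  apply: integral_ge0 => t _; rewrite mule_ge0 ?laplace_norm_ge0//.
  by rewrite lee_fin invr_ge0 powR_ge0.
have me n : D n -> measurable_fun E (e n) by move=> Dn; exact: measurable_inc_gamma (b0 n Dn).
have e0 n y : 0 <= e n y by rewrite mulr_ge0 ?inc_gamma_ge0 ?expR_ge0.
have eoo : (\esum_(n in D) ((normc (c n))%:E *
     \int[mu]_(y in E) (e n y * normc (phi y))%:E) < +oo)%E.
  apply: le_lt_trans phioo; apply: le_esum => n Dn.
  by rewrite (normc_inc_gamma k (b0 n Dn) mphi) EFinM muleA.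
have [h1 h2] := weighted_csum mphi me e0 eoo sc.
split; first exact: h1.
apply: (etrans h2); apply: eq_csum => n Dn.
have [->|c0] := eqVneq (c n) 0; first by rewrite !mul0r.
rewrite -mulrA; congr (_ * _); apply: cint_inc_gamma => //; first exact: b0.
have w0 : 0 < normc (c n) * (2 * b n) `^ (1 - k).
  rewrite mulr_gt0 ?powR_gt0 ?mulr_gt0 ?b0//.
  by rewrite lt_neqAle normc_ge0 andbT eq_sym; apply: contra_neq c0; exact: eq0_normc.
have : ((normc (c n) * (2 * b n) `^ (1 - k))%:E * X n < +oo)%E.
  apply: (@esum_lty_term _ _ D (fun n => (normc (c n) * (2 * b n) `^ (1 - k))%:E * X n)%E) => // i Di.
  by rewrite mule_ge0// lee_fin mulr_ge0 ?normc_ge0 ?powR_ge0.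
by rewrite !ltey; apply: contra_neq => Xoo; rewrite /X Xoo gt0_muley.
Qed.

(** The kernel at [y] is the kernel at [y / 2] times [2^(1 - k) e^(- b (2 t + 1) y / 2)], and the
    exponential is at most [e^(- b y / 2)] for [t > 0]. This spare decay in [b] later absorbs the
    factor [b^2]. *)
Lemma inc_gamma_half (k b y : R) : 0 < b -> 0 < y ->
  inc_gamma (1 - k) (2 * b * y) * expR (b * y) <=
  2 `^ (1 - k) * expR (- (b * (y / 2))) *
    (inc_gamma (1 - k) (2 * b * (y / 2)) * expR (b * (y / 2))).
Proof.
move=> b0 y0; have y20 : 0 < y / 2 by rewrite divr_gt0.
rewrite !inc_gamma_kernel// mulrCA ler_wpM2l ?powR_ge0//.
rewrite -RintegralZl//; [|exact: measurable_posreal|exact: integrable_gamma_kernel].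
apply: le_Rintegral; [exact: measurable_posreal|exact: integrable_gamma_kernel| |].
  have i : mu.-integrable E (fun t => (2 `^ (1 - k) * expR (- (b * (y / 2))))%:E *
      (gamma_kernel k b (y / 2) t)%:E)%E.
    by apply: integrableZl; [exact: measurable_posreal|exact: integrable_gamma_kernel].
  exact: i.
move=> t /posrealP t0; rewrite /gamma_kernel.
rewrite {1}(_ : y = 2 * (y / 2)); last by field.
rewrite (powRM _ _ (ltW y20))//.
set u := 2 `^ (1 - k); set v := (y / 2) `^ _; set w := (1 + t) `^ _.
have -> : u * expR (- (b * (y / 2))) * (v * expR (- (b * (2 * t + 1) * (y / 2))) * w) =
  u * v * (expR (- (b * (y / 2))) * expR (- (b * (2 * t + 1) * (y / 2)))) * w by ring.
rewrite ler_wpM2r ?powR_ge0// ler_wpM2l ?mulr_ge0 ?powR_ge0//.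
rewrite -expRD ler_expR.
have : 0 <= b * y * t by rewrite !mulr_ge0// ltW.
lra.
Qed.

(** The quadratic term [(e x)^2 / 2] of the exponential series gives the constant. *)
Lemma sqr_le_expR (e x : R) : 0 < e -> 0 <= x -> x ^+ 2 <= 2 / e ^+ 2 * expR (e * x).
Proof.
move=> e0 x0; have := @expR_ge1Dxn R (e * x) 1 (mulr_ge0 (ltW e0) x0).
move=> h; rewrite mulrAC ler_pdivlMr ?exprn_gt0// -ler_pdivrMl//.
have f2 : 2`!%:R = 2 :> R by [].
rewrite exprMn f2 in h; lra.
Qed.

End minus_part.

(** * Termwise differentiation *)

Section trigonometric_remainders.
Context {R : realType}.
Implicit Types x : R.

Let mvt_le (f df : R -> R) (B x : R) : 0 <= x -> f 0 = 0 ->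
  (forall y : R, is_derive y (1 : R) f (df y)) -> (forall y, 0 <= y <= x -> `|df y| <= B) ->
  `|f x| <= B * x.
Proof.
move=> x0 f0 fd dfB.
have cf : {within `[0, x], continuous f}.
  apply: continuous_subspaceT => y; apply: differentiable_continuous.
  by apply/derivable1_diffP; apply: ex_derive.
have [c] := @MVT_segment R f df 0 x x0 (fun y _ => fd y) cf.
rewrite in_itv /= f0 !subr0 => cx ->.
by rewrite normrM (ger0_norm x0) ler_wpM2r// dfB.
Qed.

Let norm_sin_le x : 0 <= x -> `|sin x| <= x.
Proof.
move=> x0; rewrite -[leRHS]mul1r; apply: (mvt_le (f := sin) (df := cos) x0 (sin0 R)) => y _.
by rewrite ler_norml cos_geN1 cos_le1.
Qed.

Let is_derive_cosB1 (y : R) : is_derive y (1 : R) (cos - cst 1 : R -> R) (- sin y).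
Proof.
have : is_derive y (1 : R) (cos - cst 1 : R -> R) (- sin y - 0) by apply: is_deriveB.
by rewrite subr0.
Qed.

Let norm_cosB1_le x : 0 <= x -> `|cos x - 1| <= x.
Proof.
move=> x0; rewrite -[leRHS]mul1r.
apply: (@mvt_le (cos - cst 1) (fun y => - sin y) _ _ x0 _ is_derive_cosB1) => [|y _].
  by rewrite /= !fctE cos0 subrr.
by rewrite normrN ler_norml sin_geN1 sin_le1.
Qed.

(** By the mean value theorem, since the derivative [- sin y] is bounded by [x] on [[0, x]]; parity
    covers negative [x]. The constant 1 is not sharp, but any constant serves for
    differentiability. *)
Lemma norm_cosB1_sqr x : `|cos x - 1| <= x ^+ 2.
Proof.
wlog x0 : x / 0 <= x => [h|].
  have [/h//|/ltW x0] := leP 0 x.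
  by rewrite -(sqrrN x) -cosN h// oppr_ge0.
rewrite expr2.
apply: (@mvt_le (cos - cst 1) (fun y => - sin y) _ _ x0 _ is_derive_cosB1) => [|y /andP[y0 yx]].
  by rewrite /= !fctE cos0 subrr.
by rewrite normrN (le_trans (norm_sin_le y0)).
Qed.

Lemma norm_sinB_sqr x : `|sin x - x| <= x ^+ 2.
Proof.
wlog x0 : x / 0 <= x => [h|].
  have [/h//|/ltW x0] := leP 0 x.
  by have := h (- x); rewrite sinN sqrrN oppr_ge0 -opprD normrN; exact.
rewrite expr2.
apply: (@mvt_le (sin - id) (fun y => cos y - 1) _ _ x0) => [|y /andP[y0 yx]].
- by rewrite /= !fctE sin0 subrr.
- by rewrite (le_trans (norm_cosB1_le y0)).
Qed.

End trigonometric_remainders.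

Section derive_csum.
Context {R : realType}.

Lemma is_derive_quadratic (H : R -> R) (d S : R) : 
  (forall u, `|H u - H 0 - u * d| <= S * u ^+ 2) -> is_derive (0 : R) 1 H d.
Proof.
move=> HS.
have S0 : 0 <= S by have := HS 1; rewrite expr1n mulr1; apply: le_trans.
have lim : (fun h : R => h^-1 *: ((H \o shift 0) (h *: 1) - H 0)) @ 0^' --> d.
  apply/cvgrPdist_le => e e0; near=> h.
  have h0 : h != 0 by near: h; exact: nbhs_dnbhs_neq.
  (* The difference quotient is off by at most [S |h|]; dividing by [S + 1] also covers [S = 0]. *)
  have he : `|h| <= e / (S + 1).
    near: h; apply: dnbhs0_le; rewrite divr_gt0//; lra.
  have -> : d - h^-1 *: ((H \o shift 0) (h *: 1) - H 0) =
      - (h^-1 * (H h - H 0 - h * d)).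
    by rewrite /= addr0 /GRing.scale /= mulr1; field.
  rewrite normrN normrM normfV ler_pdivrMl ?normr_gt0//.
  rewrite (le_trans (HS h))// -real_normK ?num_real// expr2 mulrCA ler_wpM2l//.
  rewrite ler_pdivlMr in he; last by lra.
  have := normr_ge0 h; lra.
have dH : derivable H 0 1 by apply/cvg_ex; exists d.
by apply: DeriveDef => //; exact: cvg_lim.
Unshelve. all: by end_near. Qed.

(** Quadratic remainders with summable constants add up to a quadratic remainder of the sum, which
    replaces uniform convergence of the differentiated series. *)
Lemma is_derive_rsum D (h : int -> R -> R) (d M : int -> R) :
  (forall u, (\esum_(n in D) (`|h n u|)%:E < +oo)%E) ->
  (\esum_(n in D) (`|d n|)%:E < +oo)%E -> (\esum_(n in D) (`|M n|)%:E < +oo)%E ->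
  (forall n u, D n -> `|h n u - h n 0 - u * d n| <= M n * u ^+ 2) ->
  is_derive (0 : R) 1 (fun u => rsum D (h ^~ u)) (rsum D d).
Proof.
move=> sh sd sM hM.
apply: (@is_derive_quadratic _ _ (fine (\esum_(n in D) (`|M n|)%:E)%E)) => u.
have sN (F : int -> R) : (\esum_(n in D) (`|F n|)%:E < +oo)%E ->
    (\esum_(n in D) (`|- F n|)%:E < +oo)%E.
  by move=> sF; under eq_esum do rewrite normrN.
have sMu := summableRZ (u ^+ 2) sM.
have sr : (\esum_(n in D) (`|h n u - h n 0 - u * d n|)%:E < +oo)%E.
  by apply: summableRD; [apply: summableRD => //; exact: sN|apply: sN; exact: summableRZ].
have -> : rsum D (h ^~ u) - rsum D (h ^~ 0) - u * rsum D d =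
    rsum D (fun n => h n u - h n 0 - u * d n).
  rewrite -rsumZ// -!rsumN -!rsumD//.
  - by apply: summableRD => //; exact: sN.
  - by apply: sN; exact: summableRZ.
  - exact: sN.
rewrite (le_trans (ler_norm_rsum sr))// mulrC.
rewrite -[X in X * _]/(fine (u ^+ 2)%:E) -fineM//; last first.
  by apply: ge0_fine_esum => //; under eq_esum do rewrite normr_id.
rewrite -esumZl ?sqr_ge0//.
rewrite fine_le//.
- by apply: ge0_fine_esum => //; under eq_esum do rewrite normr_id.
- apply: (@ge0_fine_esum _ _ (fun n => u ^+ 2 * `|M n|)) => [n _|].
    by rewrite mulr_ge0 ?sqr_ge0.
  by apply: summableRZ; under eq_esum do rewrite normr_id.
apply: le_esum => n Dn; rewrite -EFinM lee_fin (le_trans (hM n u Dn))// mulrC.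
by rewrite ler_wpM2l ?sqr_ge0// ler_norm.
Qed.

Lemma normc_cis (x : R) : normc (cos x +i* sin x) = 1.
Proof. by rewrite /= cos2Dsin2 sqrtr1. Qed.

Section cis.
Variables (D : set int) (A : int -> R[i]) (th : int -> R).
Hypothesis sA : csummable D A.
Hypothesis sA2 : csummable D (fun n => A n * (th n ^+ 2)%:C).

(** The first moment is dominated by the zeroth plus the second, because [|th| <= 1 + th^2]. *)
Lemma csummable_derive : csummable D (fun n => A n * (0 +i* th n)).
Proof.
apply: le_lt_trans (lte_add_pinfty sA sA2); rewrite -esumD; last 2 first.
- by move=> n _; rewrite lee_fin normc_ge0.
- by move=> n _; rewrite lee_fin normc_ge0.
apply: le_esum => n _; rewrite -EFinD lee_fin !normcM normcR.
rewrite -[X in _ <= X + _]mulr1 -mulrDr ler_wpM2l ?normc_ge0//.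
rewrite (ger0_norm (sqr_ge0 (th n))) /= expr0n add0r sqrtr_sqr.
rewrite -(real_normK (num_real (th n))).
have := sqr_ge0 (`|th n| - 1).
have -> : (`|th n| - 1) ^+ 2 = `|th n| ^+ 2 - 2 * `|th n| + 1 by ring.
by have := normr_ge0 (th n); lra.
Qed.

Let scis u : csummable D (fun n => A n * (cos (th n * u) +i* sin (th n * u))).
Proof. by apply: le_csummable sA => n _; rewrite normcM normc_cis mulr1. Qed.

(** One copy of [|A| th^2] pays for the cosine remainder and one for the sine remainder; both occur
    in the real part and in the imaginary part. *)
Let M n := 2 * (normc (A n) * th n ^+ 2).

Let sM : (\esum_(n in D) (`|M n|)%:E < +oo)%E.
Proof.
apply: summableRZ; apply: le_lt_trans sA2; apply: le_esum => n _.
by rewrite lee_fin normcM normcR normrM (ger0_norm (normc_ge0 _)).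
Qed.

Lemma is_derive_csum_Re : is_derive (0 : R) 1
  (fun u => complex.Re (csum D (fun n => A n * (cos (th n * u) +i* sin (th n * u)))))
  (complex.Re (csum D (fun n => A n * (0 +i* th n)))).
Proof.
apply: (@is_derive_rsum D _ _ M) => //.
- by move=> u; exact: csummable_Re (scis u).
- exact: csummable_Re csummable_derive.
move=> n u _; rewrite !ReMc /= mulr0 cos0 sin0.
set a := complex.Re _; set b := complex.Im _.
have -> : a * cos (th n * u) - b * sin (th n * u) - (a * 1 - b * 0) - u * (a * 0 - b * th n) =
  a * (cos (th n * u) - 1) - b * (sin (th n * u) - th n * u) by ring.
have -> : M n * u ^+ 2 = normc (A n) * (th n * u) ^+ 2 + normc (A n) * (th n * u) ^+ 2.
  by rewrite /M; ring.
rewrite (le_trans (ler_normB _ _))// !normrM lerD// ler_pM//.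
- exact: normc_geRe.
- exact: norm_cosB1_sqr.
- exact: normc_geIm.
- exact: norm_sinB_sqr.
Qed.

Lemma is_derive_csum_Im : is_derive (0 : R) 1
  (fun u => complex.Im (csum D (fun n => A n * (cos (th n * u) +i* sin (th n * u)))))
  (complex.Im (csum D (fun n => A n * (0 +i* th n)))).
Proof.
apply: (@is_derive_rsum D _ _ M) => //.
- by move=> u; exact: csummable_Im (scis u).
- exact: csummable_Im csummable_derive.
move=> n u _; rewrite !ImMc /= mulr0 cos0 sin0.
set a := complex.Re _; set b := complex.Im _.
have -> : a * sin (th n * u) + b * cos (th n * u) - (a * 0 + b * 1) - u * (a * th n + b * 0) =
  a * (sin (th n * u) - th n * u) + b * (cos (th n * u) - 1) by ring.
have -> : M n * u ^+ 2 = normc (A n) * (th n * u) ^+ 2 + normc (A n) * (th n * u) ^+ 2.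
  by rewrite /M; ring.
rewrite (le_trans (ler_normD _ _))// !normrM lerD// ler_pM//.
- exact: normc_geRe.
- exact: norm_sinB_sqr.
- exact: normc_geIm.
- exact: norm_cosB1_sqr.
Qed.

End cis.
End derive_csum.

(** * The expansion on the imaginary axis *)

Section expansion.
Context {R : realType}.
Notation mu := (@lebesgue_measure R).
Notation E := (@posreal R).

Lemma cexp_axis (th u y : R) : cexp ((0 +i* 1) * th%:C * (u +i* y)) =
  (expR (- (th * y)))%:C * (cos (th * u) +i* sin (th * u)).
Proof.
have -> : (0 +i* 1) * th%:C * (u +i* y) = (- (th * y)) +i* (th * u).
  by apply: eq_complexP => /=; ring.
by apply: eq_complexP; [rewrite ReZc|rewrite ImZc].
Qed.

Lemma csummable_plus_sqr (c : int -> R[i]) (th : int -> R) (L : R) :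
  (forall n, c n != 0 -> - L <= th n) ->
  (forall y, 0 < y -> csummable setT (fun n => c n * (expR (- (th n * y)))%:C)) ->
  forall y, 0 < y ->
  csummable setT (fun n => c n * (expR (- (th n * y)))%:C * (th n ^+ 2)%:C).
Proof.
move=> cL sc y y0; have y20 : 0 < y / 2 by rewrite divr_gt0.
(* One summand for each sign of [th n]. If [th n >= 0], half of the exponential beats the square. If
   [th n < 0], then [|th n| <= L], so the square and the other half of the exponential are
   bounded. *)
pose C : R := 2 / (y / 2) ^+ 2 + L ^+ 2 * expR (L * (y / 2)).
have C1 : 0 <= 2 / (y / 2) ^+ 2 by rewrite divr_ge0 ?sqr_ge0.
have C2 : 0 <= L ^+ 2 * expR (L * (y / 2)) by rewrite mulr_ge0 ?sqr_ge0 ?expR_ge0.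
apply: (le_csummable _ (csummableZ C%:C (sc _ y20))) => n _.
rewrite !normcM !normcR (ger0_norm (expR_ge0 _)) (ger0_norm (expR_ge0 _)).
rewrite (ger0_norm (sqr_ge0 _)) (@ger0_norm _ C) ?addr_ge0//.
have [->|c0] := eqVneq (c n) 0; first by rewrite normc0 !mul0r mulr0.
rewrite -[leLHS]mulrA [leRHS]mulrCA ler_wpM2l ?normc_ge0//.
have -> : expR (- (th n * y)) = expR (- (th n * (y / 2))) * expR (- (th n * (y / 2))).
  by rewrite -expRD; congr expR; field.
rewrite [leLHS]mulrAC ler_wpM2r ?expR_ge0//.
have [t0|/ltW t0] := leP 0 (th n).
  have := sqr_le_expR y20 t0.
  rewrite -(ler_pM2l (expR_gt0 (- (th n * (y / 2))))) => /le_trans; apply.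
  rewrite mulrCA -expRD [y / 2 * _]mulrC addNr expR0 mulr1 /C lerDl.
  exact: C2.
have Lt := cL n c0.
apply: (@le_trans _ _ (L ^+ 2 * expR (L * (y / 2)))); last by rewrite /C lerDr.
rewrite [leLHS]mulrC ler_pM ?sqr_ge0 ?expR_ge0//.
  rewrite -(sqrrN (th n)) ler_sqr ?nnegrE; lra.
rewrite ler_expR -mulNr ler_wpM2r ?(ltW y20)//; lra.
Qed.

Lemma csummable_minus_sqr D (c : int -> R[i]) (b : int -> R) (k : R) :
  let e n y := inc_gamma (1 - k) (2 * b n * y) * expR (b n * y) in
  (forall n, D n -> 0 < b n) ->
  (forall y, 0 < y -> csummable D (fun n => c n * (e n y)%:C)) ->
  forall y, 0 < y -> csummable D (fun n => c n * (e n y)%:C * (b n ^+ 2)%:C).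
Proof.
move=> e b0 sc y y0; have y20 : 0 < y / 2 by rewrite divr_gt0.
have e0 n z : 0 <= e n z by rewrite mulr_ge0 ?inc_gamma_ge0 ?expR_ge0.
(* The two factors come from [inc_gamma_half] and [sqr_le_expR]; the exponentials [e^(- b y / 2)]
   and [e^(b y / 2)] of these bounds cancel. *)
pose C : R := 2 `^ (1 - k) * (2 / (y / 2) ^+ 2).
have C0 : 0 <= C by rewrite mulr_ge0 ?powR_ge0// divr_ge0 ?sqr_ge0.
apply: (le_csummable _ (csummableZ C%:C (sc _ y20))) => n Dn.
rewrite !normcM !normcR (ger0_norm (e0 _ _)) (ger0_norm (e0 _ _)).
rewrite (ger0_norm (sqr_ge0 _)) (ger0_norm C0).
rewrite -[leLHS]mulrA [leRHS]mulrCA ler_wpM2l ?normc_ge0//.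
have h1 := inc_gamma_half k (b0 n Dn) y0.
have h2 := sqr_le_expR y20 (ltW (b0 n Dn)).
rewrite -/(e n y) -/(e n (y / 2)) in h1.
apply: (le_trans (ler_pM (e0 _ _) (sqr_ge0 _) h1 h2)).
set X := e n (y / 2).
have -> : 2 `^ (1 - k) * expR (- (b n * (y / 2))) * X * (2 / (y / 2) ^+ 2 * expR (y / 2 * b n)) =
  C * X * (expR (- (b n * (y / 2))) * expR (y / 2 * b n)) by rewrite /C; ring.
by rewrite -expRD [y / 2 * _]mulrC addNr expR0 mulr1.
Qed.

End expansion.

(** * Integrals of [f] and [delta k f] along the imaginary axis *)

Section axis.
Context {R : realType} {m : nat}.
Variables (k : R) (kap : 'I_m -> R) (cp cm : 'I_m -> int -> R[i]).
Variables (f : R[i] -> 'rV[R[i]]_m) (hf : has_expansion k kap cp cm f) (j : 'I_m).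
Notation mu := (@lebesgue_measure R).
Notation E := (@posreal R).

Let la n := 2 * pi * freq (kap j) n.
Let b n := - la n.
Let D := negfreq (kap j).
Let ep n y := expR (- (la n * y)).
Let em n y := inc_gamma (1 - k) (2 * b n * y) * expR (b n * y).
(** All dependence on [u] sits in this factor: the incomplete gamma value depends on the imaginary
    part of [tau] alone, so the weights [ep] and [em] are constants for the derivative in [u]. *)
Let cis n u := cos (la n * u) +i* sin (la n * u).

Let b_gt0 n : D n -> 0 < b n.
Proof.
by move=> Dn; rewrite /b /la oppr_gt0 pmulr_rlt0// mulr_gt0 ?pi_gt0.
Qed.

Let plusE u y : plus_term kap cp j (u +i* y) = (fun n => cp j n * (ep n y)%:C * cis n u).
Proof. by apply/funext => n; rewrite /plus_term cexp_axis mulrA. Qed.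

Let minusE u y : minus_term k kap cm j (u +i* y) =
  (fun n => cm j n * (em n y)%:C * cis n u).
Proof.
apply/funext => n; rewrite /minus_term cexp_axis -/(la n).
rewrite [in RHS]rmorphM [in RHS]mulrA [LHS]mulrA; congr (_ * _%:C * _%:C * _).
  by congr inc_gamma; rewrite /= /b /la; ring.
by rewrite /b mulNr.
Qed.

Let cis0 n : cis n 0 = 1.
Proof. by rewrite /cis mulr0 cos0 sin0. Qed.

Let plus0 y : plus_term kap cp j (0 +i* y) = (fun n => cp j n * (ep n y)%:C).
Proof. by rewrite plusE; apply/funext => n; rewrite cis0 mulr1. Qed.

Let minus0 y : minus_term k kap cm j (0 +i* y) = (fun n => cm j n * (em n y)%:C).
Proof. by rewrite minusE; apply/funext => n; rewrite cis0 mulr1. Qed.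

Let sp y : 0 < y -> csummable setT (fun n => cp j n * (ep n y)%:C).
Proof.
by move=> y0; have [/(_ j)[+ _] _] := (hf.2 (0 +i* y)) y0; rewrite plus0.
Qed.

Let sm y : 0 < y -> csummable D (fun n => cm j n * (em n y)%:C).
Proof.
by move=> y0; have [/(_ j)[_ +] _] := (hf.2 (0 +i* y)) y0; rewrite minus0.
Qed.

Let fE u y : 0 < y -> f (u +i* y) ord0 j =
  csum setT (fun n => cp j n * (ep n y)%:C * cis n u) +
  csum D (fun n => cm j n * (em n y)%:C * cis n u).
Proof. by move=> y0; have [_ ->] := (hf.2 (u +i* y)) y0; rewrite mxE plusE minusE. Qed.

Let f0E y : 0 < y -> f (0 +i* y) ord0 j =
  csum setT (fun n => cp j n * (ep n y)%:C) + csum D (fun n => cm j n * (em n y)%:C).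
Proof. by move=> y0; have [_ ->] := (hf.2 (0 +i* y)) y0; rewrite mxE plus0 minus0. Qed.

(** The coefficients are free because the lemma serves twice: with [cp], [cm] and [phi] for [f], and
    with these coefficients times [freq] and with [phi_2] for the derivative. *)
Lemma cint_expansion (dp dm : int -> R[i]) (phi : R -> R[i]) : cmeasurable phi ->
  (forall s : R, 0 < s -> laplace_abscvg (twist phi (2 - k)) s%:C) ->
  (\esum_(n in [set: int])
      ((normc (dp n))%:E * laplace_norm phi (2 * pi * freq (kap j) n))
   + \esum_(n in negfreq (kap j))
      ((normc (dm n) * (4 * pi * `|freq (kap j) n|) `^ (1 - k))%R%:E *
       \int[mu]_(t in E)
         (laplace_norm (twist phi (2 - k)) (- (2 * pi * freq (kap j) n * (2 * t + 1)))
          * (((1 + t) `^ k)^-1)%R%:E)) < +oo)%E ->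
  (forall y, 0 < y -> csummable setT (fun n => dp n * (ep n y)%:C)) ->
  (forall y, 0 < y -> csummable D (fun n => dm n * (em n y)%:C)) ->
  let P y := csum setT (fun n => dp n * (ep n y)%:C) * phi y in
  let M y := csum D (fun n => dm n * (em n y)%:C) * phi y in
  [/\ cintegrable E P, cintegrable E M,
      cint E P = csum setT (fun n => dp n * laplace phi (2 * pi * freq (kap j) n)%:C) &
      cint E M = csum (negfreq (kap j)) (fun n =>
         dm n * ((- (4 * pi * freq (kap j) n)) `^ (1 - k))%:C *
         cint E (fun t => laplace (twist phi (2 - k))
           (- (2 * pi * freq (kap j) n * (2 * t + 1)))%:C / ((1 + t) `^ k)%:C))].
Proof.
move=> mphi lphi phioo sdp sdm P M.
have bE n t : - (2 * pi * freq (kap j) n * (2 * t + 1)) = b n * (2 * t + 1).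
  by rewrite /b mulNr.
have XE n : (\int[mu]_(t in E) (laplace_norm (twist phi (2 - k))
      (- (2 * pi * freq (kap j) n * (2 * t + 1))) * (((1 + t) `^ k)^-1)%:E) =
    \int[mu]_(t in E) (laplace_norm (twist phi (2 - k)) (b n * (2 * t + 1))
      * (((1 + t) `^ k)^-1)%:E))%E.
  by apply: eq_integral => t _; rewrite bE.
have [oo1 oo2] : (\esum_(n in [set: int])
      ((normc (dp n))%:E * laplace_norm phi (la n)) < +oo)%E /\
    (\esum_(n in D) ((normc (dm n) * (2 * b n) `^ (1 - k))%:E *
     \int[mu]_(t in E) (laplace_norm (twist phi (2 - k)) (b n * (2 * t + 1))
       * (((1 + t) `^ k)^-1)%:E)) < +oo)%E.
  split; apply: le_lt_trans phioo.
    rewrite leeDl//; apply: esum_ge0 => n _; apply: mule_ge0.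
      by rewrite lee_fin mulr_ge0 ?normc_ge0 ?powR_ge0.
    apply: integral_ge0 => t _; apply: mule_ge0; first exact: laplace_norm_ge0.
    by rewrite lee_fin invr_ge0 powR_ge0.
  apply: le_trans (leeDr _ _); last first.
    apply: esum_ge0 => n _; apply: mule_ge0; first by rewrite lee_fin normc_ge0.
    exact: laplace_norm_ge0.
  apply: le_esum => n Dn.
  have -> : 4 * pi * `|freq (kap j) n| = 2 * b n.
    by rewrite ler0_norm ?(ltW Dn)// /b /la; ring.
  by rewrite XE.
have [i1 e1] := plus_part mphi oo1 sdp.
have [i2 e2] := minus_part b_gt0 mphi lphi oo2 sdm.
split; [exact: i1|exact: i2|exact: e1|].
apply: (etrans e2); apply: eq_csum => n Dn.
have -> : - (4 * pi * freq (kap j) n) = 2 * b n by rewrite /b /la; ring.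
apply: (congr1 (GRing.mul (dm n * ((2 * b n) `^ (1 - k))%:C))).
by apply: eq_cint => t _; rewrite bE.
Qed.

Lemma cint_axis phi n0 : F_f k kap n0 cp cm phi ->
  cintegrable E (fun y => f (0 +i* y) ord0 j * phi y) /\
  cint E (fun y => f (0 +i* y) ord0 j * phi y) = L_f k kap cp cm phi ord0 j.
Proof.
move=> [_ abs1 abs2 /(_ j) phioo].
have mphi : cmeasurable phi.
  apply: laplace_abscvg_cmeasurable; apply: abs1.
  by rewrite /= oppr_le0 !mulr_ge0 ?pi_ge0.
have lphi (s : R) : 0 < s -> laplace_abscvg (twist phi (2 - k)) s%:C.
  by move=> s0; exact: abs2.
have [i1 i2 e1 e2] := cint_expansion mphi lphi phioo sp sm.
have eqf y : E y -> csum setT (fun n => cp j n * (ep n y)%:C) * phi y +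
    csum D (fun n => cm j n * (em n y)%:C) * phi y = f (0 +i* y) ord0 j * phi y.
  by move=> /posrealP y0; rewrite f0E// mulrDl.
split.
  exact: (eq_cintegrable eqf (cintegrableD measurable_posreal i1 i2)).
apply: (etrans (esym (eq_cint eqf))); apply: (etrans (cintD measurable_posreal i1 i2)).
by rewrite mxE; congr (_ + _).
Qed.

Let sp2 y : 0 < y -> csummable setT (fun n => cp j n * (ep n y)%:C * (la n ^+ 2)%:C).
Proof.
move: y; have [N cN] := hf.1.
(* Nonzero coefficients have index at least [N], so [la N] bounds their frequencies from below; the
   absolute value yields a bound of the form [- L] whatever the sign of [la N]. *)
apply: (@csummable_plus_sqr _ (cp j) la (`|2 * pi * freq (kap j) N|)) => // n cn.
have Nn : N <= n by rewrite leNgt; apply: contra_neqN cn; exact: cN.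
apply: (@le_trans _ _ (la N)); first by rewrite lerNl -normrN ler_norm.
by rewrite /la ler_wpM2l ?mulr_ge0 ?pi_ge0// /freq lerD2r ler_int.
Qed.

Let sm2 y : 0 < y -> csummable D (fun n => cm j n * (em n y)%:C * (la n ^+ 2)%:C).
Proof.
move=> y0; have := csummable_minus_sqr b_gt0 sm y0.
by apply: le_csummable => n _; rewrite /b sqrrN.
Qed.

Let partial_uE y : 0 < y -> partial_u f (0 +i* y) ord0 j =
  csum setT (fun n => cp j n * (ep n y)%:C * (0 +i* la n)) +
  csum D (fun n => cm j n * (em n y)%:C * (0 +i* la n)).
Proof.
move=> y0; rewrite mxE /=.
have p1 := is_derive_csum_Re (sp y0) (sp2 y0).
have p2 := is_derive_csum_Im (sp y0) (sp2 y0).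
have m1 := is_derive_csum_Re (sm y0) (sm2 y0).
have m2 := is_derive_csum_Im (sm y0) (sm2 y0).
apply: eq_complexP; rewrite ?ReDc ?ImDc [LHS]derive1E.
  rewrite (_ : (fun u => _) =
    (fun u => complex.Re (csum setT (fun n => cp j n * (ep n y)%:C * cis n u))) +
    (fun u => complex.Re (csum D (fun n => cm j n * (em n y)%:C * cis n u)))); last first.
    by apply/funext => u; rewrite fE// ReDc.
  exact: (@derive_val _ _ _ _ _ _ _ (is_deriveD p1 m1)).
rewrite (_ : (fun u => _) =
  (fun u => complex.Im (csum setT (fun n => cp j n * (ep n y)%:C * cis n u))) +
  (fun u => complex.Im (csum D (fun n => cm j n * (em n y)%:C * cis n u)))); last first.
  by apply/funext => u; rewrite fE// ImDc.
exact: (@derive_val _ _ _ _ _ _ _ (is_deriveD p2 m2)).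
Qed.

Let freq_summable D' (A : int -> R[i]) : csummable D' A ->
  csummable D' (fun n => A n * (la n ^+ 2)%:C) ->
  csummable D' (fun n => A n * (freq (kap j) n)%:C).
Proof.
move=> sA sA2; apply: le_csummable (csummable_derive sA sA2) => n _.
rewrite !normcM ler_wpM2l ?normc_ge0// normcR /= expr0n add0r sqrtr_sqr.
rewrite /la normrM ler_peMl// ger0_norm ?mulr_ge0 ?pi_ge0//.
by have := pi_ge2 R; lra.
Qed.

(** The two imaginary units multiply to -1. The factor [y] is kept outside the sum, ready to be
    absorbed into the test function. *)
Let mul_axis D' (c : int -> R[i]) (e : int -> R -> R) y :
  csummable D' (fun n => c n * (e n y)%:C) ->
  csummable D' (fun n => c n * (e n y)%:C * (la n ^+ 2)%:C) ->
  (0 +i* y) * csum D' (fun n => c n * (e n y)%:C * (0 +i* la n)) =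
  (- (2 * pi))%:C * (y%:C * csum D' (fun n => c n * (freq (kap j) n)%:C * (e n y)%:C)).
Proof.
move=> s1 s2; have s3 := freq_summable s1 s2.
rewrite (@eq_csum _ D' (fun n => c n * (freq (kap j) n)%:C * (e n y)%:C)
  (fun n => c n * (e n y)%:C * (freq (kap j) n)%:C)); last by move=> n _; rewrite mulrAC.
rewrite -!csumZ//; [|exact: csummableZ|exact: csummable_derive].
apply: eq_csum => n _; set A := c n * _.
by apply: eq_complexP; rewrite !(ReMc, ImMc) /= /la; ring.
Qed.

Lemma cint_delta phi n0 : F_delta k kap n0 cp cm phi ->
  (k != 0 -> F_f k kap n0 cp cm phi) ->
  cintegrable E (fun y => delta k f (0 +i* y) ord0 j * phi y) /\
  cint E (fun y => delta k f (0 +i* y) ord0 j * phi y) = L_delta k kap cp cm phi ord0 j.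
Proof.
move=> [_ abs1 abs2 /(_ j) phioo] hphi.
pose phi2 := twist phi 2.
have phi2E y : 0 < y -> phi2 y = y%:C * phi y.
  by move=> y0; rewrite /phi2 /twist (_ : 2 - 1 = 1) ?powRr1 ?ltW 1?mulrC//; lra.
(* Twisting by 2 and then by [2 - k] adds the exponents 1 and [1 - k]; the equality is claimed for
   [y > 0], where exponents of [powR] add. *)
have phi3E y : 0 < y -> twist phi (3 - k) y = twist phi2 (2 - k) y.
  move=> y0; rewrite /phi2 /twist -mulrA -rmorphM /= -powRD ?(gt_eqF y0) ?implybT//.
  by congr (_ * (_ `^ _)%:C); lra.
have lnE : laplace_norm (twist phi (3 - k)) = laplace_norm (twist phi2 (2 - k)).
  by apply/funext => s; apply: eq_laplace_norm; exact: phi3E.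
have lE : laplace (twist phi (3 - k)) = laplace (twist phi2 (2 - k)).
  by apply/funext => s; apply: eq_laplace; exact: phi3E.
have mphi : cmeasurable phi.
  apply: laplace_abscvg_cmeasurable; apply: abs1.
  by rewrite /= oppr_le0 !mulr_ge0 ?pi_ge0.
have mphi2 : cmeasurable phi2.
  rewrite (_ : phi2 = fun y => (y `^ (2 - 1))%:C * phi y); last first.
    by apply/funext => y; rewrite /phi2 /twist mulrC.
  by apply: cmeasurableZ mphi; exact: measurable_fun_powR.
have lphi2 (s : R) : 0 < s -> laplace_abscvg (twist phi2 (2 - k)) s%:C.
  by move=> s0; apply: (eq_laplace_abscvg phi3E); exact: abs2.
rewrite lnE in phioo.
have sdp y : 0 < y -> csummable setT (fun n => cp j n * (freq (kap j) n)%:C * (ep n y)%:C).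
  move=> y0; apply: le_csummable (freq_summable (sp y0) (sp2 y0)) => n _.
  by rewrite mulrAC.
have sdm y : 0 < y -> csummable D (fun n => cm j n * (freq (kap j) n)%:C * (em n y)%:C).
  move=> y0; apply: le_csummable (freq_summable (sm y0) (sm2 y0)) => n _.
  by rewrite mulrAC.
have [i1 i2 e1 e2] := cint_expansion mphi2 lphi2 phioo sdp sdm.
have [i3 e3] : cintegrable E (fun y => (k / 2)%:C * (f (0 +i* y) ord0 j * phi y)) /\
    cint E (fun y => (k / 2)%:C * (f (0 +i* y) ord0 j * phi y)) =
    (k / 2)%:C * L_f k kap cp cm phi ord0 j.
  (* For [k = 0] membership in [F_f] is not given and [f phi] might not be integrable, but the
     factor [k / 2] turns the integrand into the zero function. *)
  have [k0|/hphi/cint_axis [i e]] := eqVneq k 0; last first.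
    split; first exact: (cintegrableZ _ measurable_posreal i).
    by apply: (etrans (cintZ _ measurable_posreal i)); rewrite e.
  have z y : E y -> 0 = (k / 2)%:C * (f (0 +i* y) ord0 j * phi y).
    by move=> _; rewrite k0 mul0r mul0r.
  split; first exact: (eq_cintegrable z (cintegrable0 measurable_posreal)).
  by rewrite -(eq_cint z) cint0 k0 mul0r mul0r.
have j1 := cintegrableZ (- (2 * pi))%:C measurable_posreal i1.
have j2 := cintegrableZ (- (2 * pi))%:C measurable_posreal i2.
have j12 := cintegrableD measurable_posreal j1 j2.
pose P y := csum setT (fun n => cp j n * (freq (kap j) n)%:C * (ep n y)%:C).
pose M y := csum D (fun n => cm j n * (freq (kap j) n)%:C * (em n y)%:C).
have eqf y : E y -> (- (2 * pi))%:C * (P y * phi2 y) + (- (2 * pi))%:C * (M y * phi2 y)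
    + (k / 2)%:C * (f (0 +i* y) ord0 j * phi y) = delta k f (0 +i* y) ord0 j * phi y.
  move=> /posrealP y0; rewrite /delta mxE [X in _ = (X + _) * _]mxE [X in _ = (_ + X) * _]mxE.
  have -> : (0 +i* y) * partial_u f (0 +i* y) ord0 j =
      (- (2 * pi))%:C * (y%:C * P y) + (- (2 * pi))%:C * (y%:C * M y).
    by rewrite partial_uE// mulrDr (mul_axis (sp y0) (sp2 y0)) (mul_axis (sm y0) (sm2 y0)).
  by rewrite (phi2E _ y0); ring.
split.
  exact: (eq_cintegrable eqf (cintegrableD measurable_posreal j12 i3)).
apply: (etrans (esym (eq_cint eqf))); apply: (etrans (cintD measurable_posreal j12 i3)).
rewrite (cintD measurable_posreal j1 j2) (cintZ _ measurable_posreal i1).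
rewrite (cintZ _ measurable_posreal i2) e1 e2 e3 -lE.
have rowE (c d : R[i]) (A B C : 'rV[R[i]]_m) :
    (c *: A - d *: B - d *: C) ord0 j = c * A ord0 j - d * B ord0 j - d * C ord0 j.
  by rewrite !mxE.
symmetry; apply: (etrans (rowE _ _ _ _ _)).
rewrite [X in _ - _ * X - _]mxE [X in _ - _ - _ * X]mxE.
by rewrite rmorphN !mulNr [RHS]addrC addrA.
Qed.

End axis.

(** For [k != 0] the value [L_delta] contains [(k / 2) L_f], and [F_delta] controls only the series
    weighted by [freq] and tested against [y phi(y)]; this is why part (2) also asks for [F_f] in
    that case. Absolute convergence is part of the conclusions, since [cint] has a value even for a
    divergent integral. *)
Theorem theorem3p1 (R : realType) (m : nat) (k : R)
  (hk : exists l : int, k = l%:~R / 2)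
  (kap : 'I_m -> R) (hkap : forall j : 'I_m, 0 <= kap j < 1)
  (cp cm : 'I_m -> int -> R[i])
  (f : R[i] -> 'rV[R[i]]_m) (hf : has_expansion k kap cp cm f)
  (n0 : nat) (hn0 : growth_bound n0 f) :
  (forall phi : R -> R[i], F_f k kap n0 cp cm phi ->
     axis_integrable f phi /\
     L_f k kap cp cm phi = axis_integral f phi) /\
  (forall phi : R -> R[i], F_delta k kap n0 cp cm phi ->
     (k != 0 -> F_f k kap n0 cp cm phi) ->
     axis_integrable (delta k f) phi /\
     L_delta k kap cp cm phi = axis_integral (delta k f) phi).
Proof.
split=> phi => [hphi|hphi hk0].
  split=> [j|]; first by have [] := cint_axis hf j hphi.
  by apply/rowP => j; have [_ <-] := cint_axis hf j hphi; rewrite mxE.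
split=> [j|]; first by have [] := cint_delta hf j hphi hk0.
by apply/rowP => j; have [_ <-] := cint_delta hf j hphi hk0; rewrite mxE.
Qed.
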